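(* Let $n\ge 3$ and let $m\ge 2$ be even. Let $\alpha\in\mathbb{R}$ and let $\beta$ belong to the interior of $\mathcal A_\alpha$ (the set of $\beta\in\mathbb{R}^{m-1}$ for which the radial solution $u_{\alpha,\beta}$ is global). Then $u_{\alpha,\beta}$ is a solution of $(-\Delta)^m u=e^u$ in $\mathbb{R}^n$ which is stable outside a compact set.
   Context: A function $u=u(r)$ of $r\ge 0$ is identified with the radial function $x\mapsto u(|x|)$ on $\mathbb{R}^n$, and $\Delta u(r)=u''(r)+\frac{n-1}{r}u'(r)$ for $r>0$. Solutions are classical ($C^{2m}$, including at the origin). For $\alpha\in\mathbb{R}$ and $\beta=(\beta_1,\dots,\beta_{m-1})\in\mathbb{R}^{m-1}$, $u_{\alpha,\beta}$ denotes the unique solution, on its maximal interval of continuation, of $$(-\Delta)^m u(r)=e^{u(r)},\quad u(0)=\alpha,\ u'(0)=0,\quad \Delta^k u(0)=\beta_k,\ (\Delta^k u)'(0)=0\ \text{ for } k\in\{1,\dots,m-1\},$$ and $\mathcal A_\alpha:=\{\beta\in\mathbb{R}^{m-1}:u_{\alpha,\beta}\text{ is defined on all of }[0,+\infty)\}$; the interior is taken in $\mathbb{R}^{m-1}$. For $m$ even, a solution $u\in C^{2m}(\mathbb{R}^n)$ of $(-\Delta)^m u=e^u$ in $\mathbb{R}^n$ is called stable outside a compact set $K\subset\mathbb{R}^n$ if $$\int_{\mathbb{R}^n}|\Delta^{m/2}\varphi|^2dx-\int_{\mathbb{R}^n}e^u\varphi^2dx\ge 0\qquad\text{for any }\varphi\in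 C^\infty_c(\mathbb{R}^n\setminus K).$$ It is stable outside a compact set if such a $K$ exists. *)

(* Defs.v *)
From HB Require Import structures.
From mathcomp Require Import all_boot all_order all_algebra.
From mathcomp Require Import all_classical all_reals all_analysis.
Import Order.TTheory GRing.Theory Num.Theory.
Import numFieldNormedType.Exports.
Set Implicit Arguments.
Unset Strict Implicit.
Unset Printing Implicit Defensive.
Local Open Scope classical_set_scope.
Local Open Scope ring_scope.

Lemma product_measure1_sigma_finite d1 d2 (T1 : measurableType d1)
    (T2 : measurableType d2) (R : realType)
    (m1 : {sigma_finite_measure set T1 -> \bar R})
    (m2 : {sigma_finite_measure set T2 -> \bar R}) :
  sigma_finite setT (m1 \x m2)%E.
Proof.
have /sigma_finiteP[F [TF ndF Foo]] := sigma_finiteT m1.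
have /sigma_finiteP[G [TG ndG Goo]] := sigma_finiteT m2.
exists (fun n => F n `*` G n).
  rewrite -setXTT TF TG predeqE => -[x y]; split; last first.
    by move=> [n _ []/= ? ?]; split; exists n.
  move=> [/= [n _ Fnx] [k _ Gky]]; exists (maxn n k) => //; split.
  - by move: x Fnx; exact/subsetPset/ndF/leq_maxl.
  - by move: y Gky; exact/subsetPset/ndG/leq_maxr.
move=> k; have [? ?] := Foo k; have [? ?] := Goo k.
split; first exact: measurableX.
by rewrite product_measure1E// lte_mul_pinfty// ge0_fin_numE.
Qed.

Lemma pushforward_sigma_finite d d' (T : measurableType d)
    (T' : measurableType d') (R : realType) (mu : {measure set T -> \bar R})
    (f : T -> T') (g : T' -> T) :
  measurable_fun setT f -> measurable_fun setT g -> cancel f g ->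
  sigma_finite setT mu ->
  exists nu : {sigma_finite_measure set T' -> \bar R}, pushforward mu f = nu.
Proof.
move=> mf mg fK [F FT Foo].
pose p : {measure set T' -> \bar R} :=
  measure_function_pushforward__canonical__measure_function_Measure mu mf.
have sf : sigma_finite setT p.
  exists (fun k => g @^-1` F k); first by rewrite -preimage_bigcup -FT.
  move=> k; have [mF Fk] := Foo k; split.
    by rewrite -[X in measurable X]setTI; exact: mg.
  rewrite [X in (X < _)%E](_ : _ = mu (F k))//=.
  rewrite /pushforward -comp_preimage; congr (mu _).
  by apply/seteqP; split => x /=; rewrite fK.
pose sfM := Measure_isSigmaFinite.Build _ _ _ p sf.
pose nu : {sigma_finite_measure set T' -> \bar R} :=
  HB.pack (Measure.sort p) sfM.
by exists nu.
Qed.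

Section lebesgue_tuple.
Context {R : realType}.

Definition cons_pair n (p : measurableTypeR R * n.-tuple (measurableTypeR R)) :
  n.+1.-tuple (measurableTypeR R) := [tuple of p.1 :: p.2].

Lemma measurable_cons_pair n : measurable_fun setT (@cons_pair n).
Proof. exact: measurable_cons measurable_fst measurable_snd. Qed.

(* Lebesgue measure on R^n, R^n being seen as n.-tuple R with its product
   sigma-algebra: the n-fold product of the Lebesgue measure of R. *)
Fixpoint lebesgue_tuple n : set (n.-tuple (measurableTypeR R)) -> \bar R :=
  match n with
  | 0 => dirac [tuple]
  | n'.+1 => pushforward (lebesgue_measure \x @lebesgue_tuple n')%E
               (@cons_pair n')
  end.
Arguments lebesgue_tuple n A : clear implicits.

Lemma lebesgue_tupleP n :
  exists mu : {sigma_finite_measure set (n.-tuple (measurableTypeR R)) -> \bar R},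
    lebesgue_tuple n = mu.
Proof.
elim: n => [|n [nu nuE]] /=; first by exists (dirac [tuple]).
rewrite nuE; apply: (@pushforward_sigma_finite _ _ _ _ R _ _
  (fun t => (thead t, [tuple of behead t]))).
- exact: measurable_cons_pair.
- apply/measurable_fun_pairP; split; first exact: measurable_tnth.
  exact: measurable_behead.
- by move=> [a t]; rewrite /cons_pair/= theadE; congr pair; exact/val_inj.
- exact: product_measure1_sigma_finite.
Qed.

Lemma lebesgue_tuple0 n : lebesgue_tuple n set0 = 0%E.
Proof. by have [mu ->] := lebesgue_tupleP n. Qed.

Lemma lebesgue_tuple_ge0 n A : (0 <= lebesgue_tuple n A)%E.
Proof. by have [mu ->] := lebesgue_tupleP n. Qed.

Lemma lebesgue_tuple_semi_sigma_additive n :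
  semi_sigma_additive (lebesgue_tuple n).
Proof.
have [mu ->] := lebesgue_tupleP n; exact: measure_semi_sigma_additive.
Qed.

Lemma lebesgue_tuple_sigma_finite n : sigma_finite setT (lebesgue_tuple n).
Proof. by have [mu ->] := lebesgue_tupleP n; exact: sigma_finiteT. Qed.

HB.instance Definition _ n := isMeasure.Build _ _ _ (lebesgue_tuple n)
  (lebesgue_tuple0 n) (@lebesgue_tuple_ge0 n)
  (@lebesgue_tuple_semi_sigma_additive n).

HB.instance Definition _ n := Measure_isSigmaFinite.Build _ _ _
  (lebesgue_tuple n) (@lebesgue_tuple_sigma_finite n).

Definition integral_Rn n (f : 'rV[R]_n -> R) : \bar R :=
  (\int[lebesgue_tuple n]_t (f (\row_i tnth t i))%:E)%E.

End lebesgue_tuple.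
Arguments lebesgue_tuple {R} n A.

Section calculus_Rn.
Context {R : realType} {n : nat}.
Implicit Types (f u phi : 'rV[R]_n -> R) (K : set 'rV[R]_n).

Definition basis_vec (i : 'I_n) : 'rV[R]_n := delta_mx ord0 i.

(* The norm of the normed module 'rV[R]_n is the sup norm. *)
Definition euclidean_norm (x : 'rV[R]_n) : R :=
  Num.sqrt (\sum_(i < n) x ord0 i ^+ 2).

Fixpoint is_Ck k f : Prop :=
  match k with
  | 0 => continuous f
  | k'.+1 => continuous f /\ forall i : 'I_n,
      (forall x, derivable f x (basis_vec i)) /\ is_Ck k' ('D_(basis_vec i) f)
  end.

Definition is_smooth f : Prop := forall k, is_Ck k f.

Definition laplacian f : 'rV[R]_n -> R := fun x =>
  \sum_(i < n) 'D_(basis_vec i) ('D_(basis_vec i) f) x.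

Definition entire_solution m u : Prop :=
  is_Ck (2 * m) u /\
  forall x, iter m (fun g => \- laplacian g) u x = expR (u x).

(* phi is in C_c^oo(R^n \ K), extended by 0 to R^n. *)
Definition test_function K phi : Prop :=
  [/\ is_smooth phi,
      compact (closure [set x | phi x != 0]) &
      closure [set x | phi x != 0] `<=` ~` K].

(* Meant for m even. *)
Definition stable_outside m u K : Prop :=
  forall phi, test_function K phi ->
    (0 <= integral_Rn (fun x => `|iter m./2 laplacian phi x| ^+ 2)%R
          - integral_Rn (fun x => expR (u x) * phi x ^+ 2)%R)%E.

Definition stable_outside_compact m u : Prop :=
  exists K, compact K /\ stable_outside m u K.

Definition radial (v : R -> R) : 'rV[R]_n -> R := fun x => v (euclidean_norm x).

End calculus_Rn.

Section radial_solutions.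
Context {R : realType}.
Implicit Types (u v : R -> R) (T : \bar R).

(* The profile r >= 0 |-> u r is studied through its even extension to R, i.e.
   the restriction of the radial function x |-> u |x| to a line through the
   origin; only the values of u on [0, +oo[ matter. *)
Definition even_ext u : R -> R := fun r => u `|r|.

(* Delta of a radial function with even profile v; at the origin it is the sum
   of the n second partial derivatives, each equal to v''(0), which is also the
   limit of v''(r) + (n - 1) / r * v'(r) as r -> 0. *)
Definition radial_laplacian (n : nat) v : R -> R := fun r =>
  if r == 0 then n%:R * derive1n 2 v 0
  else derive1n 2 v r + (n%:R - 1) / r * derive1 v r.

Definition is_Ck_on k T v : Prop :=
  forall (j : nat) (r : R), (j <= k)%N -> (`|r|%:E < T)%E ->
    {for r, continuous (derive1n j v)} /\ ((j < k)%N -> derivable (derive1n j v) r 1).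

(* u solves the initial value problem on [0, T[; the coordinates of beta are
   numbered from 0, i.e. beta_k is beta ord0 (k - 1). *)
Definition radial_solution (n m : nat) (alpha : R) (beta : 'rV[R]_m.-1) T u :
    Prop :=
  let v := even_ext u in
  let D k := iter k (radial_laplacian n) v in
  [/\ (0 < T)%E,
      is_Ck_on (2 * m) T v,
      (forall r, 0 <= r -> (r%:E < T)%E ->
         iter m (fun w => \- radial_laplacian n w) v r = expR (u r)),
      (u 0 = alpha /\ derive1 v 0 = 0) &
      (forall k : 'I_m.-1, D k.+1 0 = beta ord0 k /\ derive1 (D k.+1) 0 = 0)].

Arguments radial_solution : clear implicits.

(* u is u_(alpha, beta), with maximal interval of continuation [0, T[. *)
Definition maximal_radial_solution (n m : nat) (alpha : R)
    (beta : 'rV[R]_m.-1) T u : Prop :=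
  radial_solution n m alpha beta T u /\
  forall T' w, radial_solution n m alpha beta T' w -> (T' <= T)%E.
Arguments maximal_radial_solution : clear implicits.

Definition global_data (n m : nat) (alpha : R) : set 'rV[R]_m.-1 :=
  [set beta | exists u, maximal_radial_solution n m alpha beta +oo%E u].

End radial_solutions.
Arguments radial_solution {R} n m alpha beta T u.
Arguments maximal_radial_solution {R} n m alpha beta T u.
Arguments global_data {R} n m alpha.

(* Main.v *)
Require Import Defs.
From mathcomp Require Import all_boot all_order all_algebra.
From mathcomp Require Import all_classical all_reals all_analysis.
From mathcomp Require Import measurable_realfun ring lra zify.
Import Order.TTheory GRing.Theory Num.Theory.
Import numFieldNormedType.Exports.

Local Open Scope classical_set_scope.
Local Open Scope ring_scope.

Set Implicit Arguments.
Unset Strict Implicit.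
Unset Printing Implicit Defensive.

(** Write [D_k] for the [k]-th iterated radial Laplacian of the profile [v], [v] being
    extended to the whole line as an even function.

    Regularity. The coefficient [(n - 1) / r] is harmless because, for an even [v],
    the quotient [v' r / r] ([slope]) is the average of [v''] over the segment from
    [0] to [r] and so has as many derivatives as [v'']. Inverting the radial Laplacian
    gains two derivatives ([C1_inverse_radial_laplacian]); starting from
    [D_m = expR v] this makes [v] of class [C^(4 m)] ([C1_profile]). Since a partial
    derivative of [v |x|] is [x_i] times the radial function of profile [slope v],
    a profile with [2 k] derivatives gives a radial function of class [C^k]
    ([Ck_radial]), and the Laplacian of R^n acts on profiles as the radial one
    ([laplacian_radial]). The radial solution is thus an entire solution.

    Decay. As the datum [beta] is interior, raising all its coordinates slightly gives
    another global solution [w]. For [m] even the equation reads [D_m = expR v], an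
    increasing right-hand side, so all the iterated Laplacians of [w] stay above those
    of [u], the one of order [m - 1] by a fixed amount ([chain_comparison]). On the
    other hand a global solution has [D_(m-1) <= 0]: otherwise all the [D_k] would tend
    to infinity and the solution would blow up at a finite radius
    ([chain_no_blowup]). Hence [D_(m-1)] of [u] is bounded above by a negative constant,
    and integrating this down to order 0 gives [u r <= - d * r ^ 2] for [r] large, with
    [d > 0] ([profile_decay]).

    Stability. Because of this decay a crude inequality with a Gaussian weight is
    enough. For [f] smooth, compactly supported and vanishing on a large ball,
    integrating the divergence of [f ^ 2 * exp (- e |x| ^ 2) * x] bounds the weighted
    square integral of [f] by that of its gradient ([hardy]). The same weight is kept
    from one derivative to the next, and the total square integral of the second
    derivatives is that of the Laplacian; by induction the weighted square integral of
    [f] is at most a constant times the square integral of its iterated Laplacian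
    ([hardy_rellich]). Outside a larger ball [expR u] is smaller than the weight
    divided by this constant ([radial_decay_stable]).

    The integration by parts takes place on tuples with the iterated product of the
    Lebesgue measure of the line: continuous functions are measurable there
    ([measurable_continuous_row]), and partial derivatives integrate to 0 by Fubini's
    theorem ([integral_partial]). *)

(** * Directional derivatives *)

Section continuity.
Context {R : realType} {T : topologicalType}.
Implicit Types f g : T -> R.

Lemma continuous_addf f g : continuous f -> continuous g ->
  continuous (fun x => f x + g x).
Proof. by move=> cf cg x; apply: continuousD; [exact: cf|exact: cg]. Qed.

Lemma continuous_mulf f g : continuous f -> continuous g ->
  continuous (fun x => f x * g x).
Proof. by move=> cf cg x; apply: continuousM; [exact: cf|exact: cg]. Qed.

Lemma continuous_compf (h : R -> R) f : continuous h -> continuous f ->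
  continuous (fun x => h (f x)).
Proof. by move=> ch cf x; apply: continuous_comp; [exact: cf|exact: ch]. Qed.

End continuity.

Section directional.
Context {R : realType} {V : normedModType R}.
Implicit Types (f g : V -> R) (x v : V).

Lemma is_derive_addf f g x v a b : is_derive x v f a -> is_derive x v g b ->
  is_derive x v (fun y => f y + g y) (a + b).
Proof. exact: is_deriveD. Qed.

Lemma is_derive_subf f g x v a b : is_derive x v f a -> is_derive x v g b ->
  is_derive x v (fun y => f y - g y) (a - b).
Proof. exact: is_deriveB. Qed.

Lemma is_derive_oppf f x v a : is_derive x v f a ->
  is_derive x v (fun y => - f y) (- a).
Proof. exact: is_deriveN. Qed.

Lemma is_derive_mulf f g x v a b : is_derive x v f a -> is_derive x v g b ->
  is_derive x v (fun y => f y * g y) (a * g x + f x * b).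
Proof.
move=> fa gb; rewrite addrC [a * _]mulrC.
exact: (is_deriveM fa gb).
Qed.

Lemma is_derive_mulcf (c : R) f x v a : is_derive x v f a ->
  is_derive x v (fun y => c * f y) (c * a).
Proof.
move=> fa; have := is_derive_mulf (is_derive_cst c x v) fa.
by rewrite mul0r add0r.
Qed.

Lemma is_derive_sumf (I : Type) (r : seq I) (P : pred I) (f : I -> V -> R)
    (a : I -> R) x v :
  (forall i, is_derive x v (f i) (a i)) ->
  is_derive x v (fun y => \sum_(i <- r | P i) f i y) (\sum_(i <- r | P i) a i).
Proof.
move=> fa; elim: r => [|i r IH].
  rewrite big_nil (_ : (fun _ => _) = cst 0); first exact: is_derive_cst.
  by apply/funext => y; rewrite big_nil.
rewrite big_cons (_ : (fun _ => _) = if P i then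
  (fun y => f i y + \sum_(j <- r | P j) f j y) else
  (fun y => \sum_(j <- r | P j) f j y)).
  by case: (P i) => //; exact: is_derive_addf.
by apply/funext => y; rewrite big_cons; case: (P i).
Qed.

(** Reduces the chain rule, and later the mean value theorem, to functions of one
    real variable. *)
Lemma is_derive_lineP f x v a :
  is_derive x v f a <-> is_derive (0 : R) (1 : R) (fun h => f (h *: v + x)) a.
Proof.
have E : 'D_v f x = 'D_1 (fun h : R => f (h *: v + x)) 0.
  rewrite /derive; set g1 := fun h => h^-1 *: _; set g2 := fun h => h^-1 *: _.
  suff -> : g1 = g2 by []; apply/funext => h; rewrite /g1 /g2/=.
  by rewrite addr0 scale0r add0r [_%:A]mulr1.
by split=> -[df dfE]; split; by [apply/(derivable1P f x v)|rewrite -dfE].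
Qed.

Lemma is_derive_compf (g : R -> R) f x v a b :
  is_derive x v f a -> is_derive (f x) 1 g b ->
  is_derive x v (fun y => g (f y)) (b * a).
Proof.
move=> /(is_derive_lineP f x v a) fa gb; apply/(is_derive_lineP _ x v).
have gb' : is_derive ((fun h : R => f (h *: v + x)) 0) 1 g b.
  by rewrite scale0r add0r.
exact: (is_derive1_comp gb' fa).
Qed.

End directional.

(** * Functions with continuous iterated directional derivatives *)

Section Ck_class.
Context {R : realType}.

(** One class for the real line (a single direction) and for R^n (the basis
    directions), so that closure under the algebraic operations is shown once. *)
Fixpoint Ck (V : normedModType R) (I : Type) (e : I -> V) k (f : V -> R) : Prop :=
  match k with
  | 0 => continuous f
  | k'.+1 => continuous f /\ forall i : I,
      (forall x, derivable f x (e i)) /\ Ck e k' ('D_(e i) f)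
  end.

Lemma is_CkE n k (f : 'rV[R]_n -> R) :
  is_Ck k f <-> Ck (@basis_vec R n) k f.
Proof.
elim: k f => [//|k IH] f.
by split=> -[cf df]; split=> // i; have [dfi /IH] := df i.
Qed.

Section generic.
Context {V : normedModType R} {I : Type} (e : I -> V).
Implicit Types f g : V -> R.

Lemma Ck_continuous k f : Ck e k f -> continuous f.
Proof. by case: k => [//|k] []. Qed.

Lemma Ck_derivable k f i x : Ck e k.+1 f -> derivable f x (e i).
Proof. by case=> _ /(_ i)[]. Qed.

Lemma Ck_is_derive k f i x : Ck e k.+1 f -> is_derive x (e i) f ('D_(e i) f x).
Proof. by move=> /(@Ck_derivable _ _ i x)/derivableP. Qed.

Lemma Ck_derive k f i : Ck e k.+1 f -> Ck e k ('D_(e i) f).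
Proof. by case=> _ /(_ i)[]. Qed.

Lemma CkSW k f : Ck e k.+1 f -> Ck e k f.
Proof.
elim: k f => [f []//|k IH f [cf df]]; split=> // i.
by have [dfi /IH] := df i.
Qed.

Lemma Ck_le k l f : (l <= k)%N -> Ck e k f -> Ck e l f.
Proof.
move=> /subnK <-; elim: (k - l)%N => [//|d IH].
by rewrite addSn => /CkSW.
Qed.

Lemma CkS k f (df : I -> V -> R) : continuous f ->
  (forall i x, is_derive x (e i) f (df i x)) ->
  (forall i, Ck e k (df i)) -> Ck e k.+1 f.
Proof.
move=> cf fdf dfk; split => // i; split; first by move=> x; have [] := fdf i x.
rewrite (_ : 'D_(e i) f = df i)//.
by apply/funext => x; have ? := fdf i x; rewrite derive_val.
Qed.

Lemma Ck_cst k (c : R) : Ck e k (cst c).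
Proof.
elim: k c => [c|k IH c]; first exact: cst_continuous.
by apply: (@CkS _ _ (fun _ => cst 0)) => //; exact: cst_continuous.
Qed.

Lemma CkD k f g : Ck e k f -> Ck e k g -> Ck e k (fun x => f x + g x).
Proof.
elim: k f g => [f g cf cg x|k IH f g Cf Cg].
  by apply: continuousD; [exact: cf|exact: cg].
apply: (@CkS _ _ (fun i x => 'D_(e i) f x + 'D_(e i) g x)).
- move=> x; apply: continuousD; [exact: (Ck_continuous Cf)|
    exact: (Ck_continuous Cg)].
- by move=> i x; apply: is_derive_addf; [exact: Ck_is_derive Cf|exact: Ck_is_derive Cg].
- by move=> i; apply: IH; exact: Ck_derive.
Qed.

Lemma CkM k f g : Ck e k f -> Ck e k g -> Ck e k (fun x => f x * g x).
Proof.
elim: k f g => [f g cf cg x|k IH f g Cf Cg].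
  by apply: continuousM; [exact: cf|exact: cg].
apply: (@CkS _ _ (fun i x => 'D_(e i) f x * g x + f x * 'D_(e i) g x)).
- move=> x; apply: continuousM; [exact: (Ck_continuous Cf)|
    exact: (Ck_continuous Cg)].
- by move=> i x; apply: is_derive_mulf; [exact: Ck_is_derive Cf|exact: Ck_is_derive Cg].
- by move=> i; apply: CkD; apply: IH; by [exact: Ck_derive|exact: CkSW].
Qed.

Lemma CkZ k c f : Ck e k f -> Ck e k (fun x => c * f x).
Proof. by move=> Cf; apply: CkM => //; exact: Ck_cst. Qed.

Lemma CkN k f : Ck e k f -> Ck e k (fun x => - f x).
Proof.
move=> Cf; rewrite (_ : (fun _ => _) = (fun x => -1 * f x)); first exact: CkZ.
by apply/funext => x; rewrite mulN1r.
Qed.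

Lemma CkB k f g : Ck e k f -> Ck e k g -> Ck e k (fun x => f x - g x).
Proof. by move=> Cf Cg; apply: CkD => //; exact: CkN. Qed.

Lemma Ck_sum k (J : Type) (r : seq J) (f : J -> V -> R) :
  (forall j, Ck e k (f j)) -> Ck e k (fun x => \sum_(j <- r) f j x).
Proof.
move=> Cf; elim: r => [|j r IH].
  rewrite (_ : (fun _ => _) = cst 0); first exact: Ck_cst.
  by apply/funext => y; rewrite big_nil.
rewrite (_ : (fun _ => _) = (fun y => f j y + \sum_(j <- r) f j y)).
  exact: CkD.
by apply/funext => y; rewrite big_cons.
Qed.

Lemma Ck_linear k f (c : I -> R) : continuous f ->
  (forall i x, is_derive x (e i) f (c i)) -> Ck e k f.
Proof.
move=> cf fc; case: k => // k.
by apply: (@CkS _ _ (fun i => cst (c i))) => // i; exact: Ck_cst.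
Qed.

Lemma Ck_expR k f : Ck e k f -> Ck e k (fun x => expR (f x)).
Proof.
elim: k f => [f cf x|k IH f Cf].
  by apply: continuous_comp; [exact: cf|exact: continuous_expR].
apply: (@CkS _ _ (fun i x => expR (f x) * 'D_(e i) f x)).
- move=> x; apply: continuous_comp; first exact: (Ck_continuous Cf).
  exact: continuous_expR.
- by move=> i x; apply: is_derive_compf; exact: Ck_is_derive Cf.
- by move=> i; apply: CkM; [apply: IH; exact: CkSW|exact: Ck_derive].
Qed.

End generic.

Definition dir1 (_ : unit) : R := 1.

Definition C1 k (f : R -> R) : Prop := Ck dir1 k f.

Lemma C1_continuous k f : C1 k f -> continuous f.
Proof. exact: Ck_continuous. Qed.

Lemma C1SW k f : C1 k.+1 f -> C1 k f.
Proof. exact: CkSW. Qed.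

Lemma C1_le k l f : (l <= k)%N -> C1 k f -> C1 l f.
Proof. exact: Ck_le. Qed.

Lemma C1_is_derive k f (x : R) : C1 k.+1 f -> is_derive x 1 f (derive1 f x).
Proof. by move=> /(@Ck_is_derive _ _ _ _ _ tt x); rewrite derive1E. Qed.

Lemma C1_derive k f : C1 k.+1 f -> C1 k (derive1 f).
Proof.
move=> /(@Ck_derive _ _ _ _ _ tt) h.
by rewrite (_ : (derive1 f) = 'D_(dir1 tt) f)//; apply/funext => x; rewrite derive1E.
Qed.

Lemma C1S k f g : (forall x : R, is_derive x 1 f (g x)) -> C1 k g -> C1 k.+1 f.
Proof.
move=> fg Cg; apply: (@CkS _ _ _ _ _ (fun _ => g)) => // x.
exact/differentiable_continuous/derivable1_diffP/(@ex_derive _ _ _ _ _ _ _ (fg x)).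
Qed.

Lemma derive1_val f (x a : R) : is_derive x 1 f a -> derive1 f x = a.
Proof. by move=> fa; rewrite derive1E derive_val. Qed.

Lemma C1P k (f : R -> R) :
  (forall j x, (j <= k)%N -> {for x, continuous (derive1n j f)} /\
     ((j < k)%N -> derivable (derive1n j f) x 1)) -> C1 k f.
Proof.
elim: k f => [f h x|k IH f h]; first by have [] := h 0%N x erefl.
apply: (@C1S _ _ (derive1 f)).
  move=> x; rewrite derive1E; apply/derivableP.
  by have [_] := h 0%N x erefl; exact.
by apply: IH => j x jk; rewrite -derive1Sn; exact: h.
Qed.

End Ck_class.

(** * Averages along segments issued from the origin *)

Section averages.
Context {R : realType}.
Notation mu := (@lebesgue_measure R).
Implicit Types f g : R -> R.

Lemma is_derive_continuous f (x a : R) : is_derive x 1 f a -> {for x, continuous f}.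
Proof. by case=> df _; exact/differentiable_continuous/derivable1_diffP. Qed.

Lemma is_derive_pow n (x : R) : is_derive x 1 (fun t => t ^+ n.+1) (n.+1%:R * x ^+ n).
Proof.
elim: n => [|n IH]; first by rewrite expr0 mulr1; exact: is_derive_id.
apply: is_derive_eq (is_derive_mulf (is_derive_id x 1) IH) _.
by rewrite mul1r mulrCA -exprS [in RHS]mulrS mulrDl mul1r.
Qed.

Lemma is_derive_monomial q (x : R) :
  is_derive x 1 (fun r : R => r ^+ q) (q%:R * x ^+ q.-1).
Proof.
case: q => [|q]; last exact: is_derive_pow.
by rewrite mul0r; exact: (is_derive_cst (1 : R)).
Qed.

Lemma integral_derive f g (a b : R) : a < b ->
  (forall x : R, is_derive x 1 f (g x)) -> continuous g ->
  (\int[mu]_(x in `[a, b]) (g x)%:E = (f b)%:E - (f a)%:E)%E.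
Proof.
move=> ab fg cg; have cf x : {for x, continuous f}.
  exact: is_derive_continuous (fg x).
apply: continuous_FTC2 => //.
- exact: continuous_subspaceT.
- split=> [x _||].
  + by have [] := fg x.
  + exact/cvg_at_right_filter/cf.
  + exact/cvg_at_left_filter/cf.
- by move=> x _; exact: derive1_val.
Qed.

Lemma segment_integrable f (a b : R) : continuous f ->
  mu.-integrable `[a, b] (EFin \o f).
Proof.
move=> cf; apply: continuous_compact_integrable; first exact: segment_compact.
exact: continuous_subspaceT.
Qed.

Lemma segment_bounded f (a b : R) : continuous f ->
  exists2 M, 0 <= M & forall x, a <= x <= b -> `|f x| <= M.
Proof.
move=> cf; have [ab|ba] := leP a b; last first.
  by exists 0 => // x /andP[ax xb]; move: (le_trans ax xb); rewrite leNgt ba.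
have [|c _ fc] := @EVT_max R (fun x => `|f x|) a b ab.
  apply: continuous_subspaceT => x; apply: continuous_comp; first exact: cf.
  exact: norm_continuous.
by exists `|f c| => // x xab; apply: fc; rewrite in_itv.
Qed.

(** [avg k f r] is [r ^- k.+1] times the integral of [s ^ k * f s] over [0, r],
    rescaled to [0, 1] so as to be meaningful and smooth at [r = 0]. *)
Definition avg k f (r : R) : R := \int[mu]_(t in `[0, 1]) (t ^+ k * f (t * r)).

Let cont_avg_l k f r : continuous f -> continuous (fun t : R => t ^+ k * f (t * r)).
Proof.
move=> cf; apply: continuous_mulf; first exact: exprn_continuous.
apply: continuous_compf => //; exact: mulrr_continuous.
Qed.

Let cont_avg_r k f (t : R) : continuous f -> continuous (fun r : R => t ^+ k * f (t * r)).
Proof.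
move=> cf; apply: continuous_mulf; first exact: cst_continuous.
apply: continuous_compf => //; exact: mulrl_continuous.
Qed.

Let avg_bound k f (a : R) : continuous f -> exists2 M : R, 0 <= M &
  forall x t : R, `]a - 1, a + 1[%classic x -> `[0, 1]%classic t ->
  `|t ^+ k * f (t * x)| <= M.
Proof.
move=> cf; have [M M0 fM] := segment_bounded (- (`|a| + 1)) (`|a| + 1) cf.
exists M => // x t /=; rewrite !in_itv/= => /andP[ax xa] /andP[t0 t1].
rewrite normrM -[M]mul1r ler_pM//.
  by rewrite normrX (ger0_norm t0) exprn_ile1.
apply: fM; rewrite -ler_norml normrM (ger0_norm t0).
have xa1 : `|x| <= `|a| + 1.
  by rewrite -lerBlDl (le_trans (lerB_dist _ _))// ltW// ltr_distl ax.
by rewrite (le_trans _ xa1)// ler_piMl.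
Qed.

Lemma avg_continuous k f : continuous f -> continuous (avg k f).
Proof.
move=> cf a; have [M M0 fM] := avg_bound k a cf.
have Ia : a \in (`]a - 1, a + 1[%classic : set R).
  by rewrite inE/= in_itv/= ltrBlDr ltrDl ltr01.
apply: (@continuity_under_integral R _ _ mu (fun x t => t ^+ k * f (t * x))
  `[0, 1] _ (a - 1) (a + 1) _ _ (cst M)) => //.
- by move=> x _; exact: segment_integrable _ _ (@cont_avg_l k f x cf).
- by apply: (aeW mu) => t _ x _; exact: (@cont_avg_r k f t cf).
- exact: segment_integrable _ _ (@cst_continuous _ _ M).
- by move=> x Ix; apply: aeW => t It; exact: fM.
Qed.

Lemma avg_is_derive k f (a : R) : C1 1 f ->
  is_derive a 1 (avg k f) (avg k.+1 (derive1 f) a).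
Proof.
move=> Cf; have cf := C1_continuous Cf; have cf' := C1_continuous (C1_derive Cf).
have Ia : (`]a - 1, a + 1[%classic : set R) a.
  by rewrite /= in_itv/= ltrBlDr ltrDl ltr01.
pose F := fun x t : R => t ^+ k * f (t * x).
have dF (x t : R) : is_derive x 1 (F ^~ t) (t ^+ k.+1 * derive1 f (t * x)).
  have tx : is_derive x 1 (fun x => t * x) (t * 1).
    exact: is_derive_mulcf (is_derive_id x 1).
  have := is_derive_mulcf (t ^+ k) (is_derive_compf tx (C1_is_derive (t * x) Cf)).
  by rewrite mulr1 [_ * t]mulrC mulrA -exprSr.
have [M M0 fM] := avg_bound k.+1 a cf'.
have d1F x t : partial1of2 F x t = t ^+ k.+1 * derive1 f (t * x).
  by rewrite /partial1of2 (derive1_val (dF x t)).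
have intF x : (`]a - 1, a + 1[%classic : set R) x ->
    mu.-integrable `[0, 1] (EFin \o F x).
  by move=> _; exact: segment_integrable _ _ (@cont_avg_l k f x cf).
have derF x t : (`]a - 1, a + 1[%classic : set R) x ->
    (`[0, 1]%classic : set (measurableTypeR R)) t -> derivable (F ^~ t) x 1.
  by move=> _ _; have [] := dF x t.
have intM : mu.-integrable `[0, 1] (EFin \o cst M).
  exact: segment_integrable _ _ (@cst_continuous _ _ M).
have ubF x t : (`]a - 1, a + 1[%classic : set R) x ->
    (`[0, 1]%classic : set (measurableTypeR R)) t -> `|partial1of2 F x t| <= cst M t.
  by move=> Ix It; rewrite d1F; exact: fM.
have mI : measurable (`[0, 1]%classic : set (measurableTypeR R)) by [].
rewrite (_ : avg k f = fun x => \int[mu]_(t in `[0, 1]) F x t)//.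
split; first exact: (@derivable_under_integral R _ _ mu F _ mI a _ _
  Ia intF derF _ (fun=> M0) intM ubF).
rewrite -derive1E.
rewrite (@differentiation_under_integral R _ _ mu F _ mI a _ _
  Ia intF derF _ (fun=> M0) intM ubF).
by apply: eq_Rintegral => t _; exact: d1F.
Qed.

Lemma C1_avg j k f : C1 j f -> C1 j (avg k f).
Proof.
elim: j k f => [|j IH] k f Cf; first exact: avg_continuous.
apply: (@C1S _ _ _ (avg k.+1 (derive1 f))).
  by move=> x; apply: avg_is_derive; exact: Ck_le Cf.
by apply: IH; exact: C1_derive.
Qed.

Lemma avg_even k f : (forall r, f (- r) = f r) -> forall r, avg k f (- r) = avg k f r.
Proof. by move=> fE r; apply: eq_Rintegral => t _; rewrite mulrN fE. Qed.

(** Dividing by [r] a function that vanishes at the origin amounts to averaging its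
    derivative, an operation that is not singular at [r = 0]. *)
Lemma mul_avg_derive f r : C1 1 f -> r * avg 0 (derive1 f) r = f r - f 0.
Proof.
move=> Cf; have cf' := C1_continuous (C1_derive Cf).
rewrite -RintegralZl//; last exact: segment_integrable _ _ (@cont_avg_l 0 _ r cf').
pose g t := r * (t ^+ 0 * derive1 f (t * r)).
have fg (t : R) : is_derive t 1 (fun t => f (t * r)) (g t).
  rewrite /g expr0 mul1r [r * _]mulrC.
  apply: is_derive_compf; last exact: (C1_is_derive _ Cf).
  have := is_derive_mulcf r (is_derive_id t 1); rewrite mulr1.
  by under eq_fun do rewrite mulrC.
have cg : continuous g.
  apply: continuous_mulf; first exact: cst_continuous.
  exact: (@cont_avg_l 0 _ r cf').
by rewrite /Rintegral (integral_derive ltr01 fg cg)/= mul1r mul0r.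
Qed.

(** The two integrands on the left add up to the derivative of
    [t ^ k.+1 * f (t * r)] with respect to [t]. *)
Lemma avg_fundamental k f r : C1 1 f ->
  k.+1%:R * avg k f r + r * avg k.+1 (derive1 f) r = f r.
Proof.
move=> Cf; have cf := C1_continuous Cf; have cf' := C1_continuous (C1_derive Cf).
rewrite -RintegralZl//; last exact: segment_integrable _ _ (@cont_avg_l k _ r cf).
rewrite -RintegralZl//; last exact: segment_integrable _ _ (@cont_avg_l k.+1 _ r cf').
rewrite -RintegralD//; first last.
- apply: segment_integrable ; apply: continuous_mulf; first exact: cst_continuous.
  exact: (@cont_avg_l k.+1 _ r cf').
- apply: segment_integrable ; apply: continuous_mulf; first exact: cst_continuous.
  exact: (@cont_avg_l k _ r cf).
pose g t := k.+1%:R * (t ^+ k * f (t * r)) +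
  r * (t ^+ k.+1 * derive1 f (t * r)).
have fg (t : R) : is_derive t 1 (fun t => t ^+ k.+1 * f (t * r)) (g t).
  rewrite /g mulrA [r * (_ * _)]mulrCA [r * _]mulrC.
  apply: is_derive_mulf.
    exact: is_derive_pow.
  apply: is_derive_compf; last exact: (C1_is_derive _ Cf).
  have := is_derive_mulcf r (is_derive_id t 1); rewrite mulr1.
  by under eq_fun do rewrite mulrC.
have cg : continuous g.
  apply: continuous_addf; apply: continuous_mulf; try exact: cst_continuous.
    exact: (@cont_avg_l k _ r cf).
  exact: (@cont_avg_l k.+1 _ r cf').
rewrite /Rintegral (integral_derive ltr01 fg cg)/=.
by rewrite mul1r expr1n mul1r expr0n/= mul0r subr0.
Qed.

Lemma avg0 k f : continuous f -> avg k f 0 = f 0 / k.+1%:R.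
Proof.
move=> cf; rewrite /avg; under eq_Rintegral do rewrite mulr0.
have ck : continuous (fun t : R => t ^+ k) by exact: exprn_continuous.
rewrite RintegralZr//; last exact: segment_integrable.
rewrite mulrC; congr (_ * _); rewrite /Rintegral.
have fk (t : R) : is_derive t 1 (fun t => k.+1%:R^-1 * t ^+ k.+1) (t ^+ k).
  have := is_derive_mulcf k.+1%:R^-1 (is_derive_pow k t).
  by rewrite mulrA mulVf ?mul1r// pnatr_eq0.
by rewrite (integral_derive ltr01 fk ck)/= expr1n mulr1 expr0n/= mulr0 subr0.
Qed.

End averages.

(** * The radial Laplacian on even profiles *)

Section radial_laplacian.
Context {R : realType}.
Implicit Types v f : R -> R.

Definition even_fun v := forall r, v (- r) = v r.

(** For an even [v] this is [v' r / r], extended continuously to the origin. *)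
Definition slope v : R -> R := avg 0 (derive1 (derive1 v)).

Lemma derive1_even v : C1 1 v -> even_fun v ->
  forall r, derive1 v (- r) = - derive1 v r.
Proof.
move=> Cv ev r; apply/esym.
have dN : is_derive r 1 (fun x => - x) (- 1 : R).
  by apply: is_derive_oppf; exact: is_derive_id.
have := is_derive_compf dN (C1_is_derive (- r) Cv).
rewrite (_ : (fun _ => _) = v); last by apply/funext.
by move/derive1_val ->; rewrite mulrN1 opprK.
Qed.

Lemma derive1_even0 v : C1 1 v -> even_fun v -> derive1 v 0 = 0.
Proof.
move=> Cv /(derive1_even Cv)/(_ 0); rewrite oppr0 => /eqP.
by rewrite -subr_eq0 opprK -mulr2n mulrn_eq0 => /eqP.
Qed.

Lemma derive2_even v : C1 2 v -> even_fun v -> even_fun (derive1 (derive1 v)).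
Proof.
move=> Cv ev r; have Cv1 := C1_derive Cv.
have dN : is_derive r 1 (fun x => - x) (- 1 : R).
  by apply: is_derive_oppf; exact: is_derive_id.
have := is_derive_oppf (is_derive_compf dN (C1_is_derive (- r) Cv1)).
rewrite (_ : (fun _ => _) = derive1 v).
  by move/derive1_val ->; rewrite mulrN1 opprK.
apply/funext => x; rewrite (derive1_even (C1SW Cv) ev x); exact: opprK.
Qed.

Lemma mul_slope v r : C1 2 v -> even_fun v -> r * slope v r = derive1 v r.
Proof.
move=> Cv ev; rewrite /slope (mul_avg_derive r (C1_derive Cv)).
by rewrite (derive1_even0 (C1SW Cv) ev) subr0.
Qed.

Lemma slope0 v : C1 2 v -> slope v 0 = derive1 (derive1 v) 0.
Proof.
move=> Cv; rewrite /slope (avg0 0 (C1_continuous (C1_derive (C1_derive Cv)))).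
exact: divr1.
Qed.

Lemma slope_even v : C1 2 v -> even_fun v -> even_fun (slope v).
Proof. by move=> Cv ev; apply: avg_even; exact: derive2_even. Qed.

Lemma C1_slope k v : C1 k.+2 v -> C1 k (slope v).
Proof. by move=> Cv; apply: C1_avg; exact/C1_derive/C1_derive. Qed.

Lemma radial_laplacianE n v : C1 2 v -> even_fun v ->
  radial_laplacian n v = fun r => derive1 (derive1 v) r + (n%:R - 1) * slope v r.
Proof.
move=> Cv ev; apply/funext => r; rewrite /radial_laplacian.
have [->|r0] := eqVneq r 0.
  by rewrite (slope0 Cv) mulrBl mul1r addrC subrK.
by rewrite -(mul_slope r Cv ev) mulrA mulfVK.
Qed.

Lemma C1_radial_laplacian n k v : C1 k.+2 v -> even_fun v ->
  C1 k (radial_laplacian n v).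
Proof.
move=> Cv ev; rewrite (radial_laplacianE n (C1_le _ Cv) ev)//.
apply: CkD; first exact/C1_derive/C1_derive.
by apply: CkZ; exact: C1_slope.
Qed.

Lemma radial_laplacian_even n v : C1 2 v -> even_fun v ->
  even_fun (radial_laplacian n v).
Proof.
move=> Cv ev r; rewrite (radial_laplacianE n Cv ev).
by rewrite (derive2_even Cv ev r) (slope_even Cv ev r).
Qed.

Lemma iter_radial_laplacian n k j v : C1 (2 * j + k) v -> even_fun v ->
  C1 k (iter j (radial_laplacian n) v) /\ even_fun (iter j (radial_laplacian n) v).
Proof.
elim: j k => [|j IH] k Cv ev //=.
have [CL eL] : C1 k.+2 (iter j (radial_laplacian n) v) /\
    even_fun (iter j (radial_laplacian n) v).
  by apply: IH => //; rewrite (_ : 2 * j + k.+2 = 2 * j.+1 + k)%N//; lia.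
split; first exact: C1_radial_laplacian.
by apply: radial_laplacian_even => //; exact: C1_le CL.
Qed.

(** In dimension [p.+1], the radial Laplacian is a divergence: [r ^ p] is the area
    of the sphere of radius [r], up to a constant. *)
Lemma is_derive_flux p z (r : R) : C1 2 z -> even_fun z ->
  is_derive r 1 (fun r => r ^+ p * derive1 z r) (r ^+ p * radial_laplacian p.+1 z r).
Proof.
move=> Cz ez; apply: is_derive_eq (is_derive_mulf (is_derive_monomial p r)
  (C1_is_derive r (C1_derive Cz))) _.
rewrite (radial_laplacianE _ Cz ez) mulrSr addrK -(mul_slope r Cz ez).
move: (slope z r) (derive1 (derive1 z) r) => s d.
by case: p => [|q] /=; [|rewrite exprSr]; ring.
Qed.

(** Multiplying [v'' + p v' / r = f] by [r ^ p] and integrating. *)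
Lemma slope_radial_laplacian p v f : C1 2 v -> even_fun v -> C1 1 f ->
  radial_laplacian p.+1 v = f -> slope v = avg p f.
Proof.
move=> Cv ev Cf Lv; have Cv1 := C1_derive Cv.
have LE r : f r = derive1 (derive1 v) r + p%:R * slope v r.
  by rewrite -Lv (radial_laplacianE _ Cv ev) mulrSr addrK.
pose g (r : R) := r ^+ p * derive1 v r - r ^+ p.+1 * avg p f r.
have dg (r : R) : is_derive r 1 g 0.
  apply: is_derive_eq (is_derive_subf (is_derive_flux p r Cv ev)
    (is_derive_mulf (is_derive_pow p r) (avg_is_derive p r Cf))) _.
  rewrite Lv -[f r](avg_fundamental p r Cf) exprSr.
  by move: (avg p f r) (avg p.+1 (derive1 f) r) => a a'; ring.
have g0 r : g r = 0.
  rewrite (is_derive_0_is_cst r 0 dg) /g !exprS mul0r (derive1_even0 (C1SW Cv) ev).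
  by rewrite !(mulr0,mul0r) subrr.
apply/funext => r; have [->|r0] := eqVneq r 0.
  rewrite (avg0 p (C1_continuous Cf)) LE (slope0 Cv); set d := derive1 _ _.
  have -> : d + p%:R * d = d * p.+1%:R by rewrite mulrSr; ring.
  by rewrite mulfK// pnatr_eq0.
have := g0 r; rewrite /g -(mul_slope r Cv ev) mulrA -exprSr -mulrBr.
by move/eqP; rewrite mulf_eq0 expf_eq0 (negPf r0) andbF/= subr_eq0 => /eqP.
Qed.

(** Inverting the radial Laplacian gains two derivatives, as for the Laplacian
    itself; the singular coefficient costs nothing, because the slope of [v] is an
    average of [f]. *)
Lemma C1_inverse_radial_laplacian p k v : C1 2 v -> even_fun v ->
  C1 k.+1 (radial_laplacian p.+1 v) -> C1 k.+3 v.
Proof.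
move=> Cv ev CL; have Cv1 := C1_derive Cv.
apply: C1S (fun x => C1_is_derive x Cv) _; apply: C1S (fun x => C1_is_derive x Cv1) _.
have -> : derive1 (derive1 v) =
    fun r => radial_laplacian p.+1 v r - p%:R * avg p (radial_laplacian p.+1 v) r.
  apply/funext => r; rewrite -(slope_radial_laplacian Cv ev (C1_le _ CL) erefl)//.
  by rewrite (radial_laplacianE _ Cv ev) mulrSr addrK addrK.
by apply: CkB (CL) _; apply: CkZ; exact: (C1_avg p CL).
Qed.

End radial_laplacian.

(** * Radial functions on R^n *)

Section radial_functions.
Context {R : realType} {n : nat}.
Implicit Types (v : R -> R) (x : 'rV[R]_n).

Definition sqnorm x : R := \sum_(i < n) x ord0 i ^+ 2.

Lemma sqnorm_ge0 x : 0 <= sqnorm x.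
Proof. by apply: sumr_ge0 => i _; exact: sqr_ge0. Qed.

Lemma sqr_euclidean_norm x : euclidean_norm x ^+ 2 = sqnorm x.
Proof. by rewrite sqr_sqrtr// sqnorm_ge0. Qed.

Lemma euclidean_norm_ge0 x : 0 <= euclidean_norm x.
Proof. exact: sqrtr_ge0. Qed.

Lemma coord_le_euclidean_norm x i : `|x ord0 i| <= euclidean_norm x.
Proof.
rewrite -sqrtr_sqr ler_wsqrtr// (bigD1 i)//= lerDl.
by apply: sumr_ge0 => j _; exact: sqr_ge0.
Qed.

Lemma is_derive_coord j x (w : 'rV[R]_n) :
  is_derive x w (fun y : 'rV[R]_n => y ord0 j) (w ord0 j).
Proof.
apply/(is_derive_lineP _ x w).
rewrite (_ : (fun _ => _) = fun h => w ord0 j * h + x ord0 j).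
  have := is_derive_addf (is_derive_mulcf (w ord0 j) (is_derive_id (0 : R) (1 : R)))
    (is_derive_cst (x ord0 j) (0 : R) (1 : R)).
  by rewrite mulr1 addr0.
by apply/funext => h; rewrite !mxE mulrC.
Qed.

Lemma basis_vecE (i j : 'I_n) : (basis_vec i : 'rV[R]_n) ord0 j = (j == i)%:R.
Proof. by rewrite /basis_vec mxE eqxx. Qed.

Lemma Ck_coord k j : Ck (@basis_vec R n) k (fun y : 'rV[R]_n => y ord0 j).
Proof.
apply: (@Ck_linear _ _ _ _ _ _ (fun i => (j == i)%:R)).
  exact: coord_continuous.
by move=> i x; have := is_derive_coord j x (basis_vec i); rewrite basis_vecE.
Qed.

Lemma is_derive_sqnorm i x : is_derive x (basis_vec i) sqnorm (2 * x ord0 i).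
Proof.
have H j : is_derive x (basis_vec i) (fun y : 'rV[R]_n => y ord0 j ^+ 2)
    (if j == i then 2 * x ord0 i else 0).
  have dj := is_derive_coord j x (basis_vec i).
  apply: is_derive_eq (is_derive_mulf dj dj) _; rewrite basis_vecE.
  by case: eqVneq => [->|_]; rewrite ?mul0r ?mulr0 ?addr0// mul1r mulr1 mulr2n mulrDl mul1r.
apply: is_derive_eq (is_derive_sumf _ _ H) _.
by rewrite -big_mkcond big_pred1_eq.
Qed.

Lemma Ck_sqnorm k : Ck (@basis_vec R n) k sqnorm.
Proof.
by apply: Ck_sum => j; apply: CkM; exact: Ck_coord.
Qed.

Lemma euclidean_norm_continuous : continuous (@euclidean_norm R n).
Proof.
apply: (@continuous_compf _ _ (@Num.sqrt R) sqnorm); first exact: sqrt_continuous.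
exact: Ck_continuous (Ck_sqnorm 0).
Qed.

(** Away from the origin this is the chain rule through the square root. At the
    origin the norm is not differentiable, but on each axis the radial function is
    [v] itself, because [v] is even. *)
Lemma is_derive_radial v i x : C1 2 v -> even_fun v ->
  is_derive x (basis_vec i) (radial v) (x ord0 i * radial (slope v) x).
Proof.
move=> Cv ev; have [x0|x0] := eqVneq (sqnorm x) 0.
  have {x0} x0 : x = 0.
    apply/rowP => j; rewrite mxE; move/eqP: x0.
    rewrite psumr_eq0; last by move=> k _; exact: sqr_ge0.
    by move=> /allP/(_ j (mem_index_enum _)); rewrite sqrf_eq0 => /eqP.
  apply/(is_derive_lineP _ x (basis_vec i)).
  rewrite (_ : (fun _ => _) = v).
    by have := C1_is_derive 0 Cv; rewrite x0 mxE mul0r (derive1_even0 (C1SW Cv) ev).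
  apply/funext => h; rewrite /radial x0 addr0.
  have -> : euclidean_norm (h *: basis_vec i : 'rV[R]_n) = `|h|.
    rewrite -sqrtr_sqr /euclidean_norm (bigD1 i)//= big1.
      by rewrite addr0 mxE basis_vecE eqxx mulr1.
    by move=> j ji; rewrite mxE basis_vecE (negPf ji) mulr0 expr0n.
  by case: (ger0P h) => // _; rewrite (ev h).
have r0 : 0 < sqnorm x by rewrite lt_neqAle eq_sym x0 sqnorm_ge0.
have := is_derive_compf (is_derive_compf (is_derive_sqnorm i x)
  (is_derive1_sqrt r0)) (C1_is_derive (Num.sqrt (sqnorm x)) Cv).
rewrite (_ : _ * _ = x ord0 i * radial (slope v) x)//.
have s0 : Num.sqrt (sqnorm x) != 0 by rewrite gt_eqF// sqrtr_gt0.
rewrite -(mul_slope _ Cv ev) /radial /euclidean_norm -/(sqnorm x).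
by set s := Num.sqrt _ in s0 *; field.
Qed.

(** The profile has to be twice as regular as the claim, for [slope] costs two
    derivatives while producing one partial derivative. *)
Lemma Ck_radial k v : C1 (2 * k) v -> even_fun v ->
  Ck (@basis_vec R n) k (radial v).
Proof.
elim: k v => [|k IH] v Cv ev.
  by apply: continuous_compf; [exact: C1_continuous Cv|exact: euclidean_norm_continuous].
have {Cv}Cv : C1 (2 * k).+2 v by move: Cv; rewrite mulnS.
apply: (@CkS _ _ _ _ _ _ (fun i x => x ord0 i * radial (slope v) x)).
- by apply: continuous_compf; [exact: C1_continuous Cv|exact: euclidean_norm_continuous].
- by move=> i x; apply: is_derive_radial => //; exact: C1_le Cv.
- move=> i; apply: CkM; first exact: Ck_coord.
  apply: IH; first exact: C1_slope.
  by apply: slope_even => //; exact: C1_le Cv.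
Qed.

(** Differentiating [x_i * slope v |x|] once more brings in [slope (slope v)],
    whence four derivatives. *)
Lemma laplacian_radial v : C1 4 v -> even_fun v ->
  laplacian (radial v : 'rV[R]_n -> R) = radial (radial_laplacian n v).
Proof.
move=> Cv ev; have Cv2 : C1 2 v by exact: C1_le Cv.
have Cs : C1 2 (slope v) by exact: C1_slope.
have es : even_fun (slope v) by exact: slope_even.
apply/funext => x; rewrite /laplacian.
have D1 i : 'D_(basis_vec i) (radial v : 'rV[R]_n -> R) =
    fun x => x ord0 i * radial (slope v) x.
  by apply/funext => y; have ? := is_derive_radial i y Cv2 ev; rewrite derive_val.
have D2 i : 'D_(basis_vec i) ('D_(basis_vec i) (radial v : 'rV[R]_n -> R)) x =
    radial (slope v) x + x ord0 i ^+ 2 * radial (slope (slope v)) x.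
  have di := is_derive_mulf (is_derive_coord i x (basis_vec i)) (is_derive_radial i x Cs es).
  by rewrite D1 derive_val basis_vecE eqxx mul1r mulrA -expr2.
under eq_bigr do rewrite D2.
rewrite big_split/= sumr_const card_ord -mulr_suml -/(sqnorm x) -sqr_euclidean_norm.
rewrite /radial; set r := euclidean_norm x.
rewrite (radial_laplacianE n Cv2 ev).
have -> : derive1 (derive1 v) r = slope v r + r * derive1 (slope v) r.
  have -> : derive1 v = fun r => r * slope v r.
    by apply/funext => t; rewrite (mul_slope t Cv2 ev).
  rewrite (derive1_val (is_derive_mulf (is_derive_id r 1) (C1_is_derive r Cs))).
  by rewrite mul1r.
rewrite -(mul_slope r Cs es); move: (slope (slope v) r) (slope v r) => a b.
by rewrite -[b *+ n]mulr_natl; ring.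
Qed.

End radial_functions.

(** * Global solutions of the radial problem are entire solutions *)

Section global_profile.
Context {R : realType}.
Implicit Types u v : R -> R.

Lemma radial_laplacianZ n (c : R) v : C1 2 v ->
  radial_laplacian n (fun r => c * v r) = fun r => c * radial_laplacian n v r.
Proof.
move=> Cv.
have dZ f : C1 1 f -> derive1 (fun r : R => c * f r) = fun r => c * derive1 f r.
  move=> Cf; apply/funext => r.
  exact: derive1_val (is_derive_mulcf c (C1_is_derive r Cf)).
have d2 : derive1n 2 (fun r : R => c * v r) = fun r => c * derive1n 2 v r.
  by rewrite /= (dZ v (C1SW Cv)) (dZ _ (C1_derive Cv)).
apply/funext => r; rewrite /radial_laplacian d2 (dZ v (C1SW Cv)).
move: (derive1n 2 v) (derive1 v) => f g.
by case: eqP => _; rewrite !(mulrCA _ c) -?mulrDr.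
Qed.

Lemma iter_opp_radial_laplacian n j v : C1 (2 * j) v -> even_fun v ->
  iter j (fun w => \- radial_laplacian n w) v =
  fun r => (-1) ^+ j * iter j (radial_laplacian n) v r.
Proof.
elim: j => [|j IH] Cv ev; first by apply/funext => r; rewrite mul1r.
have Cj : C1 2 (iter j (radial_laplacian n) v).
  by apply: (proj1 (@iter_radial_laplacian _ n 2 j v _ ev)); move: Cv; rewrite mulnS addnC.
rewrite iterS IH//; last by apply: C1_le Cv; lia.
rewrite (radial_laplacianZ n _ Cj); apply/funext => r.
by rewrite exprS mulN1r mulNr.
Qed.

Section solution.
Variables (p m : nat) (alpha : R) (beta : 'rV[R]_m.-1) (u : R -> R).
Hypotheses (hm : (2 <= m)%N) (hm_even : ~~ odd m).
Hypothesis hu : radial_solution p.+1 m alpha beta +oo%E u.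

Let L := @radial_laplacian R p.+1.
Let v := even_ext u.

Lemma even_ext_even : even_fun v.
Proof. by move=> r; rewrite /v /even_ext normrN. Qed.

Lemma even_ext_ge0 r : 0 <= r -> v r = u r.
Proof. by move=> r0; rewrite /v /even_ext ger0_norm. Qed.

Let Cv : C1 (2 * m) v.
Proof.
case: hu => _ h _ _ _; apply: C1P => j x jm.
by apply: h => //; exact: ltry.
Qed.

Let iterL_even j : (j <= m)%N -> even_fun (iter j L v).
Proof.
move=> jm; apply: (proj2 (@iter_radial_laplacian _ p.+1 0 j v _ even_ext_even)).
by apply: C1_le Cv; lia.
Qed.

Lemma profile_eq : iter m L v = fun r => expR (v r).
Proof.
have h r : 0 <= r -> iter m L v r = expR (v r).
  move=> r0; case: hu => _ _ h _ _; rewrite even_ext_ge0// -h//; last exact: ltry.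
  rewrite (iter_opp_radial_laplacian _ Cv even_ext_even).
  by rewrite -signr_odd (negPf hm_even) mul1r.
apply/funext => r; have [/h//|r0] := leP 0 r.
rewrite -(iterL_even (leqnn m) r) -(even_ext_even r).
by apply: h; rewrite oppr_ge0 ltW.
Qed.

(** Elliptic regularity: each inversion of the radial Laplacian gains two
    derivatives, starting from the right-hand side [expR v]. *)
Lemma C1_profile j : (j <= m)%N -> C1 (2 * m + 2 * j) (iter (m - j) L v).
Proof.
elim: j => [_|j IH jm]; first by rewrite subn0 addn0 profile_eq; exact: Ck_expR.
have {}IH := IH (ltnW jm).
have E : (m - j = (m - j.+1).+1)%N by lia.
have ej := iterL_even (leq_subr j.+1 m).
have C2 : C1 2 (iter (m - j.+1) L v).
  apply: (proj1 (@iter_radial_laplacian _ p.+1 2 (m - j.+1) v _ even_ext_even)).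
  by apply: C1_le Cv; lia.
rewrite (_ : 2 * m + 2 * j.+1 = (2 * m + 2 * j).-1.+3)%N; last by lia.
apply: (@C1_inverse_radial_laplacian _ p) => //.
rewrite prednK; last by lia.
by move: IH; rewrite E.
Qed.

Lemma C1_iter_profile j : (j <= m)%N -> C1 (4 * m - 2 * j) (iter j L v).
Proof.
move=> jm; have := C1_profile (leq_subr j m).
by rewrite subKn// (_ : 2 * m + 2 * (m - j) = 4 * m - 2 * j)%N//; lia.
Qed.

Lemma iter_profile_even j : (j <= m)%N -> even_fun (iter j L v).
Proof. exact: iterL_even. Qed.

Lemma radial_even_ext : radial u = radial v :> ('rV[R]_p.+1 -> R).
Proof.
by apply/funext => x; rewrite /radial even_ext_ge0// euclidean_norm_ge0.
Qed.

(** The profile has [4 * m] derivatives, which leaves the [2 * m] required in R^n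
    after the loss in [Ck_radial]. *)
Lemma radial_entire_solution : entire_solution m (radial u : 'rV[R]_p.+1 -> R).
Proof.
rewrite radial_even_ext; split.
  apply/is_CkE; apply: Ck_radial even_ext_even.
  by have := C1_iter_profile (leq0n m); rewrite /= muln0 subn0 mulnA.
have Ej j : (j <= m)%N ->
    iter j (fun g : 'rV[R]_p.+1 -> R => \- laplacian g) (radial v) =
    radial (iter j (fun w => \- radial_laplacian p.+1 w) v).
  elim: j => [//|j IH jm]; rewrite !iterS IH; last exact: ltnW.
  have Cj : C1 (2 * j) v by apply: C1_le Cv; lia.
  have C4 : C1 4 (iter j L v).
    by apply: C1_le (C1_iter_profile (ltnW jm)); lia.
  rewrite (iter_opp_radial_laplacian _ Cj even_ext_even).
  have ej : even_fun (fun r => (-1) ^+ j * iter j L v r).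
    by move=> r; rewrite (iter_profile_even (ltnW jm) r).
  by rewrite (laplacian_radial (CkZ _ C4) ej).
move=> x; rewrite (Ej m (leqnn m)) /radial (even_ext_ge0 (euclidean_norm_ge0 x)).
by case: hu => _ _ h _ _; apply: (h _ (euclidean_norm_ge0 x)); exact: ltry.
Qed.

End solution.
End global_profile.

(** * Comparison, growth and blow-up for iterated radial Laplacians *)

Section radial_ode.
Context {R : realType}.
Variable p : nat.
Implicit Types (z : R -> R) (Y : nat -> R -> R).

Let n : R := p.+1%:R.
Let L := @radial_laplacian R p.+1.

Let n_gt0 : 0 < n. Proof. exact: ltr0Sn. Qed.

Lemma ndecr_is_derive (f df : R -> R) (a b : R) :
  (forall x : R, is_derive x 1 f (df x)) ->
  (forall x, a < x -> x < b -> 0 <= df x) ->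
  forall x y, a <= x -> x <= y -> y <= b -> f x <= f y.
Proof.
move=> fdf df0; apply: ger0_derive1_ndecr.
- by move=> x _; have [] := fdf x.
- move=> x; rewrite in_itv/= => /andP[ax xb].
  by rewrite (derive1_val (fdf x)); exact: df0.
- apply: continuous_subspaceT => x; exact: is_derive_continuous (fdf x).
Qed.

(** The flux [r ^ p * z'] vanishes at the origin and is nondecreasing as long as the
    radial Laplacian is nonnegative. *)
Lemma radial_ndecr z b : C1 2 z -> even_fun z ->
  (forall r, 0 < r -> r < b -> 0 <= L z r) ->
  (forall r, 0 <= r -> r <= b -> 0 <= derive1 z r) /\
  (forall r s, 0 <= r -> r <= s -> s <= b -> z r <= z s).
Proof.
move=> Cz ez Lz.
have dz r : 0 <= r -> r <= b -> 0 <= derive1 z r.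
  rewrite le_eqVlt => /predU1P[<- _|r0 rb]; first by rewrite (derive1_even0 (C1SW Cz) ez).
  have := ndecr_is_derive (fun x => is_derive_flux p x Cz ez)
    (a := 0) (b := b) _ (lexx 0) (ltW r0) rb.
  rewrite (derive1_even0 (C1SW Cz) ez) mulr0 pmulr_rge0 ?exprn_gt0//; apply.
  by move=> x x0 xb; rewrite mulr_ge0 ?exprn_ge0 ?(ltW x0)//; exact: Lz.
split=> // r s r0 rs sb.
apply: (ndecr_is_derive (fun x => C1_is_derive x Cz) (a := 0) (b := b)) => //.
by move=> x x0 xb; apply: dz; exact: ltW.
Qed.

(** Once [z' >= 0], a lower bound on the radial Laplacian makes [z] grow at least
    quadratically on a short interval; on it [r ^ p] varies by the factor [2 ^ p]
    at most. *)
Lemma radial_increment z a h E : C1 2 z -> even_fun z -> 1 <= a -> 0 <= h <= 1 ->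
  0 <= E -> 0 <= derive1 z a -> (forall r, a < r -> r < a + h -> E <= L z r) ->
  z a + 2 ^- p.+1 * E * h ^+ 2 <= z (a + h).
Proof.
move=> Cz ez a1 /andP[h0 h1] E0 dza Lz.
have a0 : 0 < a by exact: lt_le_trans ltr01 a1.
have aah : a <= a + h by rewrite lerDl.
have dz r : a <= r -> r <= a + h -> E * 2 ^- p * (r - a) <= derive1 z r.
  move=> ar rah; have r0 : 0 < r by exact: lt_le_trans a0 ar.
  have Q (x : R) : is_derive x 1
      (fun r => r ^+ p * derive1 z r - E * a ^+ p * r)
      (x ^+ p * L z x - E * a ^+ p).
    have := is_derive_subf (is_derive_flux p x Cz ez)
      (is_derive_mulcf (E * a ^+ p) (is_derive_id x (1 : R))).
    by rewrite mulr1.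
  have := ndecr_is_derive Q (a := a) (b := a + h) _ (lexx a) ar rah.
  rewrite lerBrDr => /(_ _)/wrap[].
    move=> x ax xh; rewrite subr_ge0 mulrC ler_pM ?exprn_ge0 ?(ltW a0)//.
      by rewrite lerXn2r ?nnegrE ?(ltW ax) ?(ltW a0)// (le_trans (ltW a0))// ltW.
    exact: Lz.
  have A0 : 0 <= a ^+ p * derive1 z a by rewrite mulr_ge0// exprn_ge0// ltW.
  move=> H; rewrite -(ler_pM2l (exprn_gt0 p r0)).
  apply: (@le_trans _ _ (E * a ^+ p * (r - a))); last first.
    by rewrite mulrBr; move: H A0; lra.
  rewrite [leLHS]mulrA; apply: ler_wpM2r; first by rewrite subr_ge0.
  rewrite mulrCA; apply: ler_wpM2l => //.
  rewrite ler_pdivrMr ?exprn_gt0// -exprMn lerXn2r ?nnegrE ?(ltW r0)//.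
    by rewrite mulr_ge0// ltW.
  by rewrite mulr_natr mulr2n (le_trans rah)// lerD2l (le_trans h1).
have Q (x : R) : is_derive x 1
    (fun r => z r - E * 2 ^- p * 2^-1 * ((r - a) * (r - a)))
    (derive1 z x - E * 2 ^- p * (x - a)).
  have dxa : is_derive x 1 (fun r => r - a) (1 : R).
    by have := is_derive_subf (is_derive_id x (1 : R)) (is_derive_cst a x 1); rewrite subr0.
  apply: is_derive_eq (is_derive_subf (C1_is_derive x Cz)
    (is_derive_mulcf (E * 2 ^- p * 2^-1) (is_derive_mulf dxa dxa))) _.
  move: (derive1 z x) => d; by field.
have := ndecr_is_derive Q (a := a) (b := a + h) _ (lexx a) aah (lexx _).
rewrite subrr mul0r mulr0 subr0 lerBrDr => /(_ _)/wrap[].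
  by move=> x ax xh; rewrite subr_ge0; apply: dz; exact: ltW.
apply: le_trans; rewrite addrAC subrr add0r -expr2 lerD2l le_eqVlt.
by apply/orP; left; apply/eqP; rewrite exprSr invfM; ring.
Qed.

(** Comparison with the parabola [c / (2 n) r ^ 2], whose radial Laplacian is [c].
    Half of its coefficient is given up to absorb the terms of lower order that come
    from the unknown values at the starting point. *)
Lemma radial_growth z (a c : R) : C1 2 z -> even_fun z -> 0 < c ->
  (forall r, a < r -> c <= L z r) ->
  exists2 b, 1 <= b & forall r, b <= r ->
    c / (4 * n) * r ^+ 2 <= z r /\ 0 <= derive1 z r.
Proof.
move=> Cz ez c0 Lz; pose a1 := Num.max a 1.
have a11 : 1 <= a1 by rewrite le_max lexx orbT.
have aa1 : a <= a1 by rewrite le_max lexx.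
pose Q r := r ^+ p * derive1 z r - c / n * r ^+ p.+1.
have dQ (x : R) : is_derive x 1 Q (x ^+ p * L z x - c * x ^+ p).
  apply: is_derive_eq (is_derive_subf (is_derive_flux p x Cz ez)
    (is_derive_mulcf (c / n) (is_derive_pow p x))) _.
  by rewrite -/n mulrA divfK// gt_eqF.
pose K : R := `|Q a1|.
have dz r : a1 <= r -> c / n * r - K <= derive1 z r.
  move=> ar; have r1 : 1 <= r by exact: le_trans a11 ar.
  have r0 : 0 < r by exact: lt_le_trans ltr01 r1.
  have QQ : Q a1 <= Q r.
    apply: (ndecr_is_derive dQ (a := a1) (b := r)) => // x ax xr.
    have x0 : 0 < x by apply: lt_trans ax; exact: lt_le_trans ltr01 a11.
    rewrite subr_ge0 mulrC ler_pM2l ?exprn_gt0//; apply: Lz.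
    exact: le_lt_trans aa1 ax.
  have : - K <= Q r by apply: le_trans QQ; rewrite /K lerNl -normrN ler_norm.
  rewrite /Q lerBrDr => KQ.
  rewrite -(ler_pM2l (exprn_gt0 p r0)) mulrBr; apply: le_trans KQ.
  rewrite mulrCA -exprSr addrC lerD2r lerN2 ler_peMl ?normr_ge0//.
  by rewrite exprn_ege1.
pose H r := z r - c / (2 * n) * (r * r) + K * r.
have dH (x : R) : is_derive x 1 H (derive1 z x - c / n * x + K).
  apply: is_derive_eq (is_derive_addf (is_derive_subf (C1_is_derive x Cz)
    (is_derive_mulcf (c / (2 * n)) (is_derive_mulf (is_derive_id x (1 : R))
      (is_derive_id x 1)))) (is_derive_mulcf K (is_derive_id x 1))) _.
  move: (derive1 z x) => d; have := gt_eqF n_gt0 => /negbT ?; by field.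
pose B := (K + `|H a1|) / (c / (4 * n)).
have cn : 0 < c / (4 * n) by rewrite divr_gt0// mulr_gt0.
exists (Num.max a1 B); first by rewrite le_max a11.
move=> r; rewrite ge_max => /andP[ar]; rewrite ler_pdivrMr// => Br.
have r1 : 1 <= r by exact: le_trans a11 ar.
have cnE : c / n = 4 * (c / (4 * n)).
  by have := gt_eqF n_gt0 => /negbT ?; field.
have cnE2 : c / (2 * n) = 2 * (c / (4 * n)).
  by have := gt_eqF n_gt0 => /negbT ?; field.
have K0 : 0 <= K by exact: normr_ge0.
have H0 : 0 <= `|H a1| by exact: normr_ge0.
split; last first.
  apply: le_trans (dz r ar); rewrite cnE subr_ge0.
  have : 0 <= c / (4 * n) * r by rewrite mulr_ge0// ltW// (lt_le_trans ltr01).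
  by move: Br H0 K0; move: (c / (4 * n)) `|H a1| => C Ha; lra.
have HH : H a1 <= H r.
  apply: (ndecr_is_derive dH (a := a1) (b := r)) => // x ax xr.
  by have := dz x (ltW ax); move: (derive1 z x) (c / n * x) => d e; lra.
have HH2 : - `|H a1| <= z r - 2 * (c / (4 * n)) * (r * r) + K * r.
  by rewrite -cnE2; apply: le_trans HH; rewrite lerNl -normrN ler_norm.
have Br2 : (K + `|H a1|) * r <= r * (c / (4 * n)) * r.
  by rewrite ler_wpM2r// (le_trans ler01).
have Hr : `|H a1| <= `|H a1| * r by rewrite ler_peMr.
rewrite -/n; move: HH2 Br2 Hr; move: (z r) (`|H a1| : R) (c / (4 * n)) => zr Ha C.
by rewrite expr2; lra.
Qed.

End radial_ode.

Section radial_chain.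
Context {R : realType}.
Variable p : nat.
Implicit Types (z : R -> R) (Y : nat -> R -> R).

Let L := @radial_laplacian R p.+1.

Definition radial_chain m Y := forall k, (k < m)%N ->
  [/\ C1 2 (Y k), even_fun (Y k) & L (Y k) = Y k.+1].

(** Each term inherits the sign of its radial Laplacian, the next term, by
    integration from the origin, where it is nonnegative. *)
Lemma chain_nonneg m Y b : (0 < m)%N -> radial_chain m Y ->
  (forall k, (k < m)%N -> 0 <= Y k 0) ->
  (forall r, 0 < r -> r < b -> 0 <= Y m.-1 r) ->
  forall k, (k < m)%N -> forall r, 0 < r -> r < b -> 0 <= Y k r.
Proof.
move=> m0 YL Y0 Ym k km.
have -> : k = (m.-1 - (m.-1 - k))%N by lia.
move: (m.-1 - k)%N (leq_subr k m.-1) => j; elim: j => [|j IH] jm r r0 rb.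
  by rewrite subn0; exact: Ym.
have jm' : (m.-1 - j.+1 < m)%N by lia.
have [Cz ez Lz] := YL _ jm'.
have Lz0 s : 0 < s -> s < b -> 0 <= L (Y (m.-1 - j.+1)%N) s.
  move=> s0 sb; rewrite Lz (_ : (m.-1 - j.+1).+1 = m.-1 - j)%N; last by lia.
  by apply: IH => //; lia.
have [_ H] := radial_ndecr Cz ez Lz0.
exact: le_trans (Y0 _ jm') (H 0 r (lexx 0) (ltW r0) (ltW rb)).
Qed.

(** Comparison principle. As long as the last but one term stays positive, so do
    all the lower ones, hence also the top one, which makes the last but one term
    nondecreasing: it can never drop to half of its initial value. *)
Lemma chain_comparison m Y : (0 < m)%N -> radial_chain m Y ->
  (forall k, (k < m)%N -> 0 <= Y k 0) -> 0 < Y m.-1 0 ->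
  (forall r, 0 <= Y 0%N r -> 0 <= Y m r) ->
  forall r, 0 <= r -> Y m.-1 0 <= Y m.-1 r.
Proof.
move=> m0 YL Y0 Ym0 Ytop.
have mm : (m.-1 < m)%N by lia.
have [Cm em Lm] := YL _ mm.
set e := Y m.-1 0 in Ym0 *.
have top b : (forall r, 0 < r -> r < b -> 0 <= Y m.-1 r) ->
    forall r, 0 <= r -> r <= b -> e <= Y m.-1 r.
  move=> Yb r r0 rb; have Lm0 s : 0 < s -> s < b -> 0 <= L (Y m.-1) s.
    move=> s0 sb; rewrite Lm prednK//; apply: Ytop.
    exact: (chain_nonneg m0 YL Y0 Yb m0 s0 sb).
  by have [_ H] := radial_ndecr Cm em Lm0; exact: H.
suff pos r : 0 <= r -> e / 2 < Y m.-1 r.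
  move=> r r0; apply: (top r) => // s s0 _.
  by apply: ltW; apply: lt_trans (pos s (ltW s0)); rewrite divr_gt0.
move=> r0; rewrite ltNge; apply/negP => rlow.
pose A : set R := `[0, r]%classic `&` [set s | Y m.-1 s <= e / 2].
have cA : compact A.
  apply: (@subclosed_compact _ _ `[0, r]%classic); last 2 first.
  - exact: segment_compact.
  - by move=> s [].
  apply: closedI; first exact: interval_closed.
  apply: (@closed_comp _ _ (Y m.-1) [set y | y <= e / 2]).
    by move=> s _; exact: (C1_continuous Cm).
  exact: closed_le.
have A0 : A !=set0 by exists r; split => //=; rewrite in_itv/= lexx andbT.
have cid : {within A, continuous (id : R -> R)}.
  by apply: continuous_subspaceT => x; exact: cvg_id.
have [c + cmin] := compact_EVT_min A0 cA cid.
rewrite inE => -[/=]; rewrite in_itv/= => /andP[c0 cr] clow.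
have : e <= Y m.-1 c.
  apply: (top c) => // s s0 sc; have : ~ A s.
    by move=> As; have := cmin s (mem_set As); rewrite leNgt sc.
  move=> nAs; rewrite leNgt; apply/negP => sneg; apply: nAs; split => /=.
    by rewrite in_itv/= (ltW s0)/= (le_trans (ltW sc)).
  by apply: ltW; apply: lt_trans sneg _; rewrite divr_gt0.
move: clow; rewrite -/e; lra.
Qed.

(** A positive lower bound on one term forces quadratic growth of the term below. *)
Lemma chain_lower_bound m Y a c : radial_chain m Y -> (0 < m)%N -> 0 < c ->
  (forall r, a <= r -> c <= Y m.-1 r) ->
  forall k, (k < m)%N -> exists2 b, 1 <= b &
    exists2 c', 0 < c' & forall r, b <= r -> c' <= Y k r.
Proof.
move=> YL m0 c0 Ym k km.
have -> : k = (m.-1 - (m.-1 - k))%N by lia.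
move: (m.-1 - k)%N (leq_subr k m.-1) => j; elim: j => [|j IH] jm.
  exists (Num.max a 1); first by rewrite le_max lexx orbT.
  exists c => // r; rewrite ge_max => /andP[ar _]; rewrite subn0; exact: Ym.
have [|b b1 [d d0 Yd]] := IH; first by lia.
have jm' : (m.-1 - j.+1 < m)%N by lia.
have [Cz ez Lz] := YL _ jm'.
have Ld r : b < r -> d <= L (Y (m.-1 - j.+1)%N) r.
  move=> br; rewrite Lz (_ : (m.-1 - j.+1).+1 = m.-1 - j)%N; last by lia.
  exact/Yd/ltW.
have [b' b'1 H] := radial_growth Cz ez d0 Ld.
have q0 : 0 < d / (4 * p.+1%:R) by rewrite divr_gt0// mulr_gt0// ltr0Sn.
exists b' => //; exists (d / (4 * p.+1%:R)) => // r br.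
have [H1 _] := H r br; apply: le_trans H1; rewrite ler_peMr ?(ltW q0)//.
by rewrite exprn_ege1// (le_trans b'1).
Qed.

Lemma common_bound (m : nat) (P : nat -> R -> Prop) :
  (forall k, (k < m)%N -> exists b, forall r, b <= r -> P k r) ->
  exists2 b, 1 <= b & forall k, (k < m)%N -> forall r, b <= r -> P k r.
Proof.
elim: m => [|m IH] H; first by exists 1.
have [|b b1 Hb] := IH; first by move=> k km; apply: H; exact: ltnW.
have [b' Hb'] := H m (ltnSn m).
exists (Num.max b b'); first by rewrite le_max b1.
move=> k; rewrite ltnS leq_eqVlt => /predU1P[->|km] r; rewrite ge_max => /andP[br b'r].
  exact: Hb'.
exact: Hb.
Qed.

(** The engine of blow-up: on each step of length [h] the lower bound on one term is
    passed on to the term below with a factor [2 ^- p.+1 * h ^ 2], so that after [m]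
    steps the bound on [Y m = expR (Y 0)] has reached [Y 0] itself. *)
Lemma chain_increment m Y b a h : (0 < m)%N -> radial_chain m Y ->
  Y m = (fun r => expR (Y 0%N r)) -> 1 <= b ->
  (forall k, (k < m)%N -> forall r, b <= r -> 0 <= Y k r /\ 0 <= derive1 (Y k) r) ->
  b <= a -> 0 <= h <= 1 ->
  Y 0%N a + (2 ^- p.+1 * h ^+ 2) ^+ m * expR (Y 0%N a) <= Y 0%N (a + m%:R * h).
Proof.
move=> m0 YL Ym b1 Yb ba /andP[h0 h1].
have nd k : (k < m)%N -> forall r s, b <= r -> r <= s -> Y k r <= Y k s.
  move=> km r s br rs; have [Cz _ _] := YL k km.
  apply: (ndecr_is_derive (fun x => C1_is_derive x Cz) (a := b) (b := s)) => //.
  by move=> x bx _; have [] := Yb k km x (ltW bx).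
set q := 2 ^- p.+1 * h ^+ 2; set E := expR (Y 0%N a).
have q0 : 0 <= q by rewrite mulr_ge0// ?exprn_ge0// invr_ge0 exprn_ge0.
have E0 : 0 <= E by exact: expR_ge0.
have step j : (j < m)%N ->
    (forall r, a + j%:R * h <= r -> q ^+ j * E <= Y (m - j)%N r) ->
    forall r, a + j.+1%:R * h <= r ->
      Y (m - j.+1)%N (r - h) + q ^+ j.+1 * E <= Y (m - j.+1)%N r.
  move=> jm IH r; rewrite -natr1 mulrDl mul1r addrA => rh.
  have rh' : a + j%:R * h <= r - h by rewrite lerBrDr.
  have jm' : (m - j.+1 < m)%N by lia.
  have jE : (m - j.+1).+1 = (m - j)%N by lia.
  have br : b <= r - h.
    by rewrite (le_trans ba)// (le_trans _ rh')// lerDl mulr_ge0.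
  have [Cz ez Lz] := YL _ jm'.
  have [_ dz] := Yb _ jm' _ br.
  have Lq s : r - h < s -> s < r - h + h -> q ^+ j * E <= L (Y (m - j.+1)%N) s.
    move=> rs sr; rewrite Lz jE.
    by apply: IH; apply: le_trans rh' (ltW rs).
  have h01 : 0 <= h <= 1 by rewrite h0.
  have := radial_increment Cz ez (le_trans b1 br) h01 (mulr_ge0 (exprn_ge0 _ q0) E0) dz Lq.
  rewrite subrK; apply: le_trans; rewrite lerD2l exprS.
  rewrite le_eqVlt; apply/orP; left; apply/eqP; rewrite {1}/q.
  by move: (q ^+ j) (2 ^- p.+1) => x y; ring.
have all j : (j < m)%N -> forall r, a + j%:R * h <= r -> q ^+ j * E <= Y (m - j)%N r.
  elim: j => [_ r|j IH jm r rh].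
    rewrite mul0r addr0 => ar; rewrite expr0 mul1r subn0 Ym ler_expR.
    exact: nd.
  apply: le_trans (step j (ltnW jm) (IH (ltnW jm)) r rh).
  rewrite lerDr; have jm' : (m - j.+1 < m)%N by lia.
  apply: (proj1 (Yb _ jm' _ _)); rewrite lerBrDr.
  apply: le_trans rh; rewrite -natr1 mulrDl mul1r addrA lerD2r.
  by rewrite (le_trans ba)// lerDl mulr_ge0.
have mm : (m.-1 < m)%N by lia.
have := step _ mm (all _ mm) (a + m%:R * h).
rewrite prednK// subnn => /(_ (lexx _)); apply: le_trans; rewrite lerD2r.
apply: nd => //; rewrite -(prednK m0) -natr1 mulrDl mul1r addrA addrK.
by rewrite lerDl mulr_ge0.
Qed.

(** If the last but one term were positive somewhere, all the terms would tend to
    infinity, and steps of lengths [2 ^- j] would increase [Y 0] by [2 m] each,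
    although their total length is finite. *)
Lemma chain_no_blowup m Y : (1 < m)%N -> radial_chain m Y ->
  Y m = (fun r => expR (Y 0%N r)) -> forall r, 0 <= r -> Y m.-1 r <= 0.
Proof.
move=> m1 YL Ym r r0; rewrite leNgt; apply/negP => Yr.
have m0 : (0 < m)%N by exact: ltnW.
have mm : (m.-1 < m)%N by lia.
have [Cm em Lm] := YL _ mm.
have top b : forall s, 0 < s -> s < b -> 0 <= radial_laplacian p.+1 (Y m.-1) s.
  by move=> s _ _; rewrite -/L Lm prednK// Ym expR_ge0.
have low s : r <= s -> Y m.-1 r <= Y m.-1 s.
  by move=> rs; have [_ H] := radial_ndecr Cm em (@top s); exact: H.
have all k : (k < m)%N -> exists b, forall s, b <= s ->
    0 <= Y k s /\ 0 <= derive1 (Y k) s.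
  move=> km; have [b b1 [c c0 Yc]] := chain_lower_bound YL m0 Yr low km.
  have [kE|km'] := eqVneq k m.-1.
    exists b => s bs; split; first by rewrite (le_trans (ltW c0))// Yc.
    have [H _] := radial_ndecr Cm em (@top s); rewrite kE; apply: H => //.
    by rewrite (le_trans ler01)// (le_trans b1).
  have km1 : (k.+1 < m)%N by lia.
  have [b' b'1 [c' c'0 Yc']] := chain_lower_bound YL m0 Yr low km1.
  have [Ck ek Lk] := YL _ km.
  have Lc s : b' < s -> c' <= L (Y k) s by move=> bs; rewrite Lk; exact/Yc'/ltW.
  have [b2 b21 H] := radial_growth Ck ek c'0 Lc.
  exists (Num.max b b2) => s; rewrite ge_max => /andP[bs b2s]; split.
    by rewrite (le_trans (ltW c0))// Yc.
  by have [] := H s b2s.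
have [b b1 Yb] := common_bound all.
pose kap : R := 2 ^- p.+1; have kap0 : 0 < kap by rewrite invr_gt0 exprn_gt0.
(* With this M, the first gain kap ^ m * expR M is at least 2 m. *)
pose M := 2 * m%:R / kap ^+ m.
have M0 : 0 <= M by rewrite divr_ge0 ?exprn_ge0 ?(ltW kap0)// mulr_ge0.
have [b2 bb2 YM] : exists2 b2, b <= b2 & M <= Y 0%N b2.
  have [b' b'1 [c' c'0 Yc']] := chain_lower_bound YL m0 Yr low m1.
  have [C0 e0 L0] := YL _ m0.
  have Lc s : b' < s -> c' <= L (Y 0%N) s by move=> bs; rewrite L0; exact/Yc'/ltW.
  have [b3 b31 H] := radial_growth C0 e0 c'0 Lc.
  have q0 : 0 < c' / (4 * p.+1%:R) by rewrite divr_gt0// mulr_gt0// ltr0Sn.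
  pose b4 := Num.max b (Num.max b3 (M / (c' / (4 * p.+1%:R)))).
  have b3b4 : b3 <= b4 by rewrite !le_max lexx orbT.
  exists b4; first by rewrite le_max lexx.
  have b41 : 1 <= b4 by exact: le_trans b31 b3b4.
  have [H1 _] := H b4 b3b4; apply: le_trans H1.
  have : M / (c' / (4 * p.+1%:R)) <= b4 by rewrite !le_max lexx !orbT.
  rewrite ler_pdivrMr// [b4 * _]mulrC => /le_trans; apply.
  by rewrite ler_wpM2l ?(ltW q0)// expr2 ler_peMr// (le_trans ler01).
(* A j is reached from b2 by m steps of each of the lengths 1, 1/2, ..., 2 ^- (j - 1). *)
pose A (j : nat) : R := b2 + m%:R * (2 - 2 * 2 ^- j).
have A_ge j : b <= A j.
  rewrite (le_trans bb2)// lerDl mulr_ge0// subr_ge0 ler_piMr// invf_le1 ?exprn_gt0//.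
  by rewrite exprn_ege1// ler1n.
have A_S j : A j.+1 = A j + m%:R * 2 ^- j.
  by rewrite /A exprS invfM; move: (2 ^- j) => x; field.
have YA j : M + 2 * m%:R * j%:R <= Y 0%N (A j).
  elim: j => [|j IH].
    by rewrite mulr0 addr0 /A expr0 invr1 mulr1 subrr mulr0 addr0.
  pose h : R := 2 ^- j; have h01 : 0 <= h <= 1.
    apply/andP; split; first by rewrite invr_ge0 exprn_ge0.
    by rewrite invf_le1 ?exprn_gt0// exprn_ege1// ler1n.
  have := chain_increment m0 YL Ym b1 Yb (A_ge j) h01; rewrite /h.
  rewrite -A_S; apply: le_trans.
  rewrite -[j.+1%:R]natr1 mulrDr mulr1 addrA; apply: lerD => //.
  apply: (@le_trans _ _ (kap ^+ m * M)).
    by rewrite /M [leRHS]mulrC divfK// expf_neq0// gt_eqF.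
  rewrite exprMn -mulrA; apply: ler_wpM2l; first by rewrite exprn_ge0// ltW.
  (* The factor (2 ^- j) ^ (2 m) lost on short steps is recovered from
     expR (2 m j), since expR 1 >= 2. *)
  apply: (@le_trans _ _ (((2 ^- j) ^+ 2) ^+ m * expR (M + 2 * m%:R * j%:R))); last first.
    by apply: ler_wpM2l; rewrite ?exprn_ge0 ?invr_ge0 ?exprn_ge0// ler_expR.
  rewrite expRD mulrCA; have : M <= expR M by have := expR_ge1Dx M; lra.
  move=> /le_trans; apply; rewrite ler_peMr ?expR_ge0//.
  have -> : 2 * m%:R * j%:R = (j * 2 * m)%:R * 1 :> R.
    by rewrite mulr1 !natrM; ring.
  rewrite expRM_natl !exprM -!exprMn exprn_ege1// exprn_ege1//.
  rewrite -exprVn -exprMn exprn_ege1//.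
  have := @expR_ge1Dx R 1; lra.
have YB j : Y 0%N (A j) <= Y 0%N (b2 + m%:R * 2).
  have [C0 _ _] := YL _ m0.
  apply: (ndecr_is_derive (fun x => C1_is_derive x C0) (a := b) (b := b2 + m%:R * 2)) => //.
    by move=> x bx _; have [] := Yb _ m0 x (ltW bx).
  rewrite lerD2l ler_wpM2l// gerBl mulr_ge0// invr_ge0 exprn_ge0//.
pose y := Y 0%N (b2 + m%:R * 2).
have [j jY] : exists j : nat, `|y| < j%:R.
  by exists (Num.bound `|y|); exact: (archi_boundP (normr_ge0 y)).
have h1 : M + 2 * m%:R * j%:R <= y by exact: le_trans (YA j) (YB j).
have h2 : j%:R <= 2 * m%:R * j%:R :> R by rewrite ler_peMl// -natrM ler1n; lia.
move: h1 h2 M0 (ler_norm y) jY; move: (2 * m%:R * j%:R : R) => x; lra.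
Qed.

End radial_chain.

(** * Decay of the profile of an interior datum *)

Section profile_decay.
Context {R : realType}.

Lemma radial_laplacianB n (f g : R -> R) : C1 2 f -> C1 2 g ->
  radial_laplacian n (fun r => f r - g r) =
  fun r => radial_laplacian n f r - radial_laplacian n g r.
Proof.
move=> Cf Cg.
have dB a b : C1 1 a -> C1 1 b ->
    derive1 (fun r : R => a r - b r) = fun r => derive1 a r - derive1 b r.
  move=> Ca Cb; apply/funext => r.
  exact: derive1_val (is_derive_subf (C1_is_derive r Ca) (C1_is_derive r Cb)).
have d2 : derive1n 2 (fun r : R => f r - g r) = fun r => derive1n 2 f r - derive1n 2 g r.
  by rewrite /= (dB f g (C1SW Cf) (C1SW Cg)) (dB _ _ (C1_derive Cf) (C1_derive Cg)).
apply/funext => r; rewrite /radial_laplacian d2 (dB f g (C1SW Cf) (C1SW Cg)).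
move: (derive1n 2 f) (derive1 f) (derive1n 2 g) (derive1 g) => a b c d.
by case: eqP => _; ring.
Qed.

Variables (p m : nat) (alpha : R).
Hypotheses (hm : (2 <= m)%N) (hm_even : ~~ odd m).

Let L := @radial_laplacian R p.+1.

Lemma radial_chain_profile beta (u : R -> R) :
  radial_solution p.+1 m alpha beta +oo%E u ->
  radial_chain p m (fun k => iter k L (even_ext u)).
Proof.
move=> hu k km; split=> //.
- by apply: C1_le (C1_iter_profile hm hm_even hu (ltnW km)); lia.
- exact: (iter_profile_even hm hm_even hu (ltnW km)).
Qed.

Let value0 beta (u : R -> R) k : radial_solution p.+1 m alpha beta +oo%E u ->
  iter k L (even_ext u) 0 =
  if k is k'.+1 then
    if insub k' is Some i then beta ord0 i else iter k L (even_ext u) 0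
  else alpha.
Proof.
case=> _ _ _ [u0 _] h; case: k => [|k] /=; first by rewrite /even_ext normr0.
case: insubP => [i ki E|//]; have [H _] := h i; by rewrite -H E.
Qed.

(** Raising the data by [e / 2] gives another global solution [w] above [u]. As [w]
    does not blow up, the last Laplacian of [w] is nonpositive, so that of [u] is
    at most [- e / 2]; integrating back, [u] decays at least quadratically. *)
Lemma profile_decay beta T (u : R -> R) :
  (global_data p.+1 m alpha)° beta ->
  maximal_radial_solution p.+1 m alpha beta T u ->
  radial_solution p.+1 m alpha beta +oo%E u /\
  exists2 d, 0 < d & exists b, forall r, b <= r -> u r <= - d * r ^+ 2.
Proof.
move=> hbeta [hu hmax].
have gb : global_data p.+1 m alpha beta by exact: interior_subset hbeta.
have TE : T = +oo%E.
  case: gb => u' [hu' _]; apply/eqP; rewrite -leye_eq; exact: hmax hu'.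
rewrite {}TE in hu hmax *; split => //.
have [e e0 he] : exists2 e : R, 0 < e & ball beta e `<=` global_data p.+1 m alpha.
  by move: hbeta => /nbhs_ballP[e /= e0 he]; exists e.
have [w [hw _]] : global_data p.+1 m alpha (beta + const_mx (e / 2)).
  apply: he; split => // i j; rewrite !mxE /ball/= opprD addNKr normrN.
  by rewrite ger0_norm ?divr_ge0 ?ltW// ltr_pdivrMr// ltr_pMr// ltr1n.
have cu := radial_chain_profile hu; have cw := radial_chain_profile hw.
pose Z k := fun r => iter k L (even_ext w) r - iter k L (even_ext u) r.
have cZ : radial_chain p m Z.
  move=> k km; have [Cu eu Lu] := cu k km; have [Cw ew Lw] := cw k km; split.
  - exact: (CkB Cw Cu).
  - by move=> r; rewrite /Z (eu r) (ew r).
  - exact: (radial_laplacianB p.+1 Cw Cu).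
have Zk0 k : (k < m)%N -> Z k 0 = if k is 0%N then 0 else e / 2.
  move=> km; rewrite /Z (value0 k hu) (value0 k hw); case: k km => [|k] km.
    by rewrite subrr.
  case: insubP => [i _ _|]; last by rewrite (_ : (k < m.-1)%N)//; lia.
  by rewrite !mxE addrAC subrr add0r.
have m1E : m.-1 = m.-2.+1 by lia.
have e20 : 0 < e / 2 by rewrite divr_gt0.
have Ym r : 0 <= r -> iter m.-1 L (even_ext u) r <= - (e / 2).
  move=> r0.
  have : Z m.-1 0 <= Z m.-1 r.
    apply: (chain_comparison _ cZ) => //; first by lia.
    - by move=> k km; rewrite Zk0//; case: (k) => // _; exact: ltW.
    - rewrite Zk0; last by lia.
      by rewrite m1E.
    - move=> s; rewrite /Z /= (profile_eq hm hm_even hu) (profile_eq hm hm_even hw).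
      by rewrite !subr_ge0 ler_expR.
  rewrite Zk0; last by lia.
  rewrite m1E -m1E /Z; have := chain_no_blowup hm cw (profile_eq hm hm_even hw) r0.
  by move: (iter _ _ (even_ext u) r) (iter _ _ (even_ext w) r) => a b; lra.
pose X k := fun r => -1 * iter k L (even_ext u) r.
have cX : radial_chain p m X.
  move=> k km; have [Cu eu Lu] := cu k km; split.
  - exact: (CkZ (-1) Cu).
  - by move=> r; rewrite /X (eu r).
  - exact: (radial_laplacianZ p.+1 (-1) Cu).
have Xm r : 0 <= r -> e / 2 <= X m.-1 r.
  by move=> /Ym; rewrite /X mulN1r lerNr.
have [b b1 [c c0 Xc]] := chain_lower_bound cX (ltnW hm) e20 Xm hm.
have [C0 E0 L0] := cX 0%N (ltnW hm).
have Lc s : b < s -> c <= radial_laplacian p.+1 (X 0%N) s.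
  by move=> bs; rewrite L0; exact/Xc/ltW.
have [b' b'1 H] := radial_growth C0 E0 c0 Lc.
exists (c / (4 * p.+1%:R)); first by rewrite divr_gt0// mulr_gt0// ltr0Sn.
exists b' => r br; have [+ _] := H r br.
have r0 : 0 <= r by rewrite (le_trans ler01)// (le_trans b'1).
by rewrite /X /= /even_ext ger0_norm// mulN1r mulNr lerNr.
Qed.

End profile_decay.

(** * Lebesgue integration of compactly supported continuous functions on R^n *)

Section tuple_integral.
Context {R : realType}.
Local Notation tuple_R n := (n.-tuple (measurableTypeR R)).
Local Notation lambda := (@lebesgue_measure R).

Definition row_of n (t : tuple_R n) : 'rV[R]_n := \row_i tnth t i.

Definition cons_row n (s : R) (y : 'rV[R]_n) : 'rV[R]_n.+1 :=
  \row_k (if unlift ord0 k is Some j then y ord0 j else s).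

Lemma cons_row0 n s (y : 'rV[R]_n) : cons_row s y ord0 ord0 = s.
Proof. by rewrite mxE unlift_none. Qed.

Lemma cons_rowS n s (y : 'rV[R]_n) j : cons_row s y ord0 (lift ord0 j) = y ord0 j.
Proof. by rewrite mxE liftK. Qed.

Lemma row_of_cons n (a : measurableTypeR R * tuple_R n) :
  row_of (cons_pair a) = cons_row a.1 (row_of a.2).
Proof.
apply/rowP => k; rewrite !mxE; case: unliftP => [j ->|->].
  by rewrite tnthS mxE.
by rewrite tnth0.
Qed.

Let box_of n (qk : n.-tuple rat * nat) : set (tuple_R n) :=
  [set t | forall i, `|tnth t i - ratr (tnth qk.1 i)| < qk.2.+1%:R^-1].

Let measurable_box_of n qk : measurable (@box_of n qk).
Proof.
rewrite (_ : box_of qk = \bigcap_(i in [set: 'I_n])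
  ((fun t : tuple_R n => tnth t i) @^-1`
    `]ratr (tnth qk.1 i) - qk.2.+1%:R^-1, ratr (tnth qk.1 i) + qk.2.+1%:R^-1[%classic)).
  apply: fin_bigcap_measurable => // i _.
  rewrite -[X in measurable X]setTI; exact: measurable_tnth.
apply/seteqP; split => t /= h i; first by move=> _; rewrite /= in_itv/= -ltr_distl; exact: h.
by have := h i Logic.I; rewrite /= in_itv/= -ltr_distl.
Qed.

(** The Borel sets of R^n belong to the product sigma-algebra: an open set is a
    countable union of rational boxes. *)
Lemma measurable_open_row n (O : set 'rV[R]_n) : open O ->
  measurable [set t : tuple_R n | O (row_of t)].
Proof.
move=> oO.
pose inO qk := forall t : tuple_R n, box_of qk t -> O (row_of t).
rewrite (_ : [set t | _] = \bigcup_(qk : n.-tuple rat * nat)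
    (if `[< inO qk >] then box_of qk else set0)).
  apply: countable_bigcupT_measurable => [|qk]; first exact: countableP.
  by case: ifP => _; [exact: measurable_box_of|exact: measurable0].
apply/seteqP; split => [t Ot|t [qk _]]; last by case: asboolP => // h /h.
have [e /= e0 eO] : exists2 e : R, 0 < e & ball (row_of t) e `<=` O.
  by have /nbhs_ballP[e /= e0 he] := open_nbhs_nbhs (conj oO Ot); exists e.
have [k ke] : exists k : nat, k.+1%:R^-1 < e / 2.
  have e2 : 0 < e / 2 by rewrite divr_gt0.
  have [k _ hk] := near_infty_natSinv_lt (PosNum e2).
  by exists k; apply: hk => /=.
have k0 : (0 : R) < k.+1%:R^-1 by rewrite invr_gt0 ltr0Sn.
have /choice[q qP] : forall i : 'I_n, exists q : rat, `|tnth t i - ratr q| < k.+1%:R^-1.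
  move=> i; have : tnth t i - k.+1%:R^-1 < tnth t i + k.+1%:R^-1 :> R.
    by rewrite ltrBlDr -addrA ltrDl addr_gt0.
  by move=> /rat_in_itvoo[q]; rewrite in_itv/= -ltr_distl distrC => ?; exists q.
exists ([tuple q i | i < n], k) => //; case: asboolP => [_ i|[]].
  by rewrite tnth_mktuple; exact: qP.
move=> s sq; apply: eO; split => // i0 i; rewrite !mxE /ball/=.
have := sq i; rewrite /= tnth_mktuple => si; have ti := qP i.
rewrite (le_lt_trans (ler_distD (ratr (q i)) _ _))// [e]splitr ltrD//.
  exact: lt_trans ti ke.
by rewrite distrC; exact: lt_trans si ke.
Qed.

Lemma measurable_continuous_row n (f : 'rV[R]_n -> R) : continuous f ->
  measurable_fun [set: tuple_R n] (fun t => f (row_of t)).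
Proof.
move=> /continuousP cf; apply: (measurability _ (RGenOpens.measurableE R)).
move=> _ [_ [a [b ->] <-]]; rewrite setTI.
exact: measurable_open_row (cf _ (interval_open _ _)).
Qed.

Definition box n (M : R) : set (tuple_R n) := [set t | forall i, `|tnth t i| <= M].

Lemma measurable_box n M : measurable (@box n M).
Proof.
rewrite (_ : @box n M = \bigcap_(i in [set: 'I_n])
    ((fun t : tuple_R n => tnth t i) @^-1` `[- M, M]%classic)).
  apply: fin_bigcap_measurable => // i _.
  rewrite -[X in measurable X]setTI; exact: measurable_tnth.
apply/seteqP; split => t /= h i; first by move=> _; rewrite /= in_itv/= -ler_norml; exact: h.
by have := h i Logic.I; rewrite /= in_itv/= -ler_norml.
Qed.

Lemma box_finite n M : (lebesgue_tuple n (@box n M) < +oo)%E.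
Proof.
elim: n => [|n IH].
  by rewrite /= diracE; case: (_ \in _); rewrite ltry.
rewrite /= /pushforward.
have -> : @cons_pair R n @^-1` box M = (`[- M, M]%classic : set R) `*` @box n M.
  apply/seteqP; split => [[s t] /= h|[s t] [/= hs ht] i].
    split => /=; first by have := h ord0; rewrite tnth0 in_itv/= ler_norml.
    by move=> i; have := h (lift ord0 i); rewrite tnthS.
  case: (unliftP ord0 i) => [j ->|->]; first by rewrite tnthS; exact: ht.
  by rewrite tnth0 ler_norml; move: hs; rewrite in_itv.
rewrite product_measure1E//; last exact: measurable_box.
rewrite lte_mul_pinfty// ?ge0_fin_numE//.
by rewrite /= lebesgue_measure_itv/=; case: ifP => _; rewrite -?EFinB ltry.
Qed.

Definition cbox n (M : R) (f : 'rV[R]_n -> R) :=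
  continuous f /\ forall x : 'rV[R]_n, (exists i, M < `|x ord0 i|) -> f x = 0.

Lemma cbox_bounded n M (f : 'rV[R]_n -> R) : cbox M f ->
  exists2 B, 0 <= B & forall x, `|f x| <= B.
Proof.
move=> [cf f0].
pose K := [set x : 'rV[R]_n | forall i, `[- M, M]%classic (x ord0 i)].
have cK : compact K.
  by apply: (@rV_compact _ _ (fun=> `[- M, M]%classic)) => _; exact: segment_compact.
have cfn : continuous (fun x => `|f x|).
  by apply: (continuous_compf _ cf); exact: norm_continuous.
have out x : ~ K x -> f x = 0.
  move=> nK; apply: f0; apply: contrapT => h; apply: nK => i /=.
  rewrite in_itv/= -ler_norml leNgt; apply/negP => Mx; apply: h; by exists i.
have [K0|K0] := eqVneq K set0.
  by exists 0 => // x; rewrite out ?normr0// K0.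
have [|c _ cmax] := compact_EVT_max _ cK (continuous_subspaceT cfn); first exact/set0P.
exists `|f c| => // x; have [Kx|/out->] := pselect (K x).
  by apply: cmax; rewrite inE.
by rewrite normr0.
Qed.

Lemma cbox_integrable n M (f : 'rV[R]_n -> R) : cbox M f ->
  (lebesgue_tuple n).-integrable [set: tuple_R n] (fun t => (f (row_of t))%:E).
Proof.
move=> cf; have [B B0 fB] := cbox_bounded cf.
apply: (@le_integrable _ _ _ _ setT measurableT _ (fun t => (B * \1_(@box n M) t)%:E)).
- by apply/measurable_EFinP; exact: measurable_continuous_row cf.1.
- move=> t _; rewrite !abse_EFin lee_fin.
  have [tM|tM] := pselect (box M t).
    by rewrite indicE mem_set// mulr1 (ger0_norm B0); exact: fB.
  rewrite cf.2 ?normr0//; apply: contrapT => h; apply: tM => i.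
  rewrite leNgt; apply/negP => Mt; apply: h; exists i; by rewrite mxE.
- under eq_fun do rewrite EFinM.
  apply: integrableZl => //; apply/integrableP; split.
    by apply/measurable_EFinP; apply: measurable_indic; exact: measurable_box.
  under eq_integral do rewrite gee0_abs//.
  by rewrite integral_indic ?setIT; [exact: box_finite| |exact: measurable_box].
Qed.

Lemma integral_cons n M (f : 'rV[R]_n.+1 -> R) : cbox M f ->
  (lebesgue_measure \x lebesgue_tuple n)%E.-integrable setT
    (fun a => (f (cons_row a.1 (row_of a.2)))%:E) /\
  (\int[lebesgue_tuple n.+1]_t (f (row_of t))%:E =
   \int[lebesgue_measure \x lebesgue_tuple n]_a (f (cons_row a.1 (row_of a.2)))%:E)%E.
Proof.
move=> cf; have mcp := @measurable_cons_pair R n.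
have mf : measurable_fun setT (fun t : tuple_R n.+1 => (f (row_of t))%:E).
  by apply/measurable_EFinP; exact: measurable_continuous_row cf.1.
have /integrableP[_ ioo] := cbox_integrable cf.
have E : (fun a : measurableTypeR R * tuple_R n => (f (cons_row a.1 (row_of a.2)))%:E) =
    (fun t => (f (row_of t))%:E) \o @cons_pair R n.
  by apply/funext => a /=; rewrite row_of_cons.
have intf : (lebesgue_measure \x lebesgue_tuple n)%E.-integrable setT
    (fun a : measurableTypeR R * tuple_R n => (f (cons_row a.1 (row_of a.2)))%:E).
  apply/integrableP; rewrite E; split; first exact: measurableT_comp.
  move: ioo; rewrite /= ge0_integral_pushforward//.
    rewrite preimage_setT; apply: le_lt_trans; rewrite le_eqVlt; apply/orP; left.
    by apply/eqP; apply: eq_integral => a _ /=; rewrite row_of_cons.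
  apply/measurable_EFinP; apply: measurableT_comp; first exact: normr_measurable.
  exact: measurable_continuous_row cf.1.
split=> //; rewrite E in intf *; rewrite /= integral_pushforward//.
Qed.

End tuple_integral.

(** * Integration by parts *)

Section partial_integral.
Context {R : realType}.
Local Notation tuple_R n := (n.-tuple (measurableTypeR R)).
Local Notation lambda := (@lebesgue_measure R).

Lemma derive_vanish (V : normedModType R) (O : set V) (f : V -> R) v :
  open O -> (forall x, O x -> f x = 0) -> forall x, O x -> 'D_v f x = 0.
Proof.
move=> oO f0 x Ox; rewrite (@near_eq_derive _ _ _ f (cst 0)) ?derive_cst//.
by have := open_nbhs_nbhs (conj oO Ox); apply: filterS => y /f0.
Qed.

Lemma open_outside_box n (M : R) :
  open [set x : 'rV[R]_n | exists i, M < `|x ord0 i|].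
Proof.
rewrite (_ : mkset _ = \bigcup_(i in [set: 'I_n])
    ((fun x : 'rV[R]_n => `|x ord0 i|) @^-1` [set r | M < r])).
  apply: bigcup_open => i _; apply: open_comp; last exact: open_gt.
  move=> x _; apply: continuous_comp; first exact: coord_continuous.
  exact: norm_continuous.
by apply/seteqP; split => [x [i h]|x [i _ h]]; exists i.
Qed.

Lemma cbox_derive n (M : R) (f : 'rV[R]_n -> R) i : Ck (@basis_vec R n) 1 f ->
  cbox M f -> cbox M ('D_(basis_vec i) f).
Proof.
move=> Cf [_ f0]; split; first exact: (Ck_derive i Cf).
by move=> x Mx; apply: (derive_vanish _ (@open_outside_box n M)).
Qed.

Lemma integral_derive_line (g : R -> R) (M : R) : C1 1 g ->
  (forall s, M < `|s| -> g s = 0) -> (\int[lambda]_s (derive1 g s)%:E = 0)%E.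
Proof.
move=> Cg g0; pose N : R := `|M| + 1.
have MN : M < N by rewrite (le_lt_trans (ler_norm _))// ltrDl.
have N0 : 0 < N by rewrite ltr_wpDl.
have oM : open [set s : R | M < `|s|].
  rewrite (_ : mkset _ = (fun s : R => `|s|) @^-1` [set r | M < r])//.
  by apply: open_comp => [s _|]; [exact: norm_continuous|exact: open_gt].
have dg0 s : M < `|s| -> derive1 g s = 0.
  by move=> Ms; rewrite derive1E; apply: (derive_vanish _ oM).
transitivity (\int[lambda]_(s in `[(- N)%R, N]) (derive1 g s)%:E)%E.
  rewrite [RHS]integral_mkcond; apply: eq_integral => s _; rewrite patchE.
  case: ifPn => //; rewrite notin_setE/= in_itv/= -ler_norml => /negP.
  by rewrite -ltNge => Ns; rewrite dg0// (lt_trans MN).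
have NN : - N < N by rewrite gtrN.
rewrite (integral_derive NN (fun x : R => C1_is_derive x Cg) (C1_derive Cg)).
by rewrite !g0 ?normrN ?(gtr0_norm N0)// sube0.
Qed.

Lemma cons_row_continuous n (s : R) : continuous (@cons_row R n s).
Proof.
move=> y A /nbhs_ballP[e /= e0 eA]; apply/nbhs_ballP; exists e => //= z [_ yz].
apply: eA; split=> // i k; rewrite !mxE.
by case: unliftP => [j _|_]; [exact: yz|exact: ballxx].
Qed.

Lemma cons_row_line0 n (s h : R) (y : 'rV[R]_n) :
  h *: basis_vec ord0 + cons_row s y = cons_row (h + s) y.
Proof.
apply/rowP => k; rewrite mxE mxE basis_vecE; case: (unliftP ord0 k) => [j ->|->].
  by rewrite !cons_rowS/= mulr0 add0r.
by rewrite !cons_row0 eqxx mulr1.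
Qed.

Lemma cons_row_lineS n (s h : R) (y : 'rV[R]_n) j :
  h *: basis_vec (lift ord0 j) + cons_row s y = cons_row s (h *: basis_vec j + y).
Proof.
apply/rowP => k; rewrite mxE mxE basis_vecE; case: (unliftP ord0 k) => [l ->|->].
  by rewrite !cons_rowS mxE mxE basis_vecE (inj_eq lift_inj).
by rewrite !cons_row0 (_ : ord0 == _ = false) ?mulr0 ?add0r//; apply/negbTE/neq_lift.
Qed.

Lemma is_derive_cons_row0 n (f : 'rV[R]_n.+1 -> R) y (s : R) d :
  is_derive (cons_row s y) (basis_vec ord0) f d ->
  is_derive s 1 (fun s => f (cons_row s y)) d.
Proof.
move=> /(is_derive_lineP f (cons_row s y)) h; apply/(is_derive_lineP _ s (1 : R)).
rewrite (_ : (fun _ => _) = (fun h => f (h *: basis_vec ord0 + cons_row s y)))//.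
by apply/funext => r; rewrite cons_row_line0 [_%:A]mulr1.
Qed.

Lemma is_derive_cons_rowS n (f : 'rV[R]_n.+1 -> R) y (s : R) j d :
  is_derive (cons_row s y) (basis_vec (lift ord0 j)) f d ->
  is_derive y (basis_vec j) (fun y => f (cons_row s y)) d.
Proof.
move=> /(is_derive_lineP f (cons_row s y)) h; apply/(is_derive_lineP _ y).
rewrite (_ : (fun _ => _) = (fun h => f (h *: basis_vec (lift ord0 j) + cons_row s y)))//.
by apply/funext => r; rewrite cons_row_lineS.
Qed.

(** Fubini's theorem, integrating first along the line of the derivative when it is
    the first coordinate, and over the other coordinates, by induction on the
    dimension, when it is not. *)
Lemma integral_partial n M (f : 'rV[R]_n -> R) i : Ck (@basis_vec R n) 1 f ->
  cbox M f ->
  (\int[lebesgue_tuple n]_t ('D_(basis_vec i) f (row_of t))%:E = 0)%E.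
Proof.
elim: n f i => [f []//|n IH f i Cf bf].
have bD := cbox_derive i Cf bf.
have [intD ->] := integral_cons bD.
have Cslice k : Ck (@basis_vec R n.+1) k f -> forall s, continuous (fun y => f (cons_row s y)).
  move=> Cf' s y; apply: continuous_comp; first exact: cons_row_continuous.
  exact: (Ck_continuous Cf').
case: (unliftP ord0 i) => [j|] iE; rewrite iE in bD intD *.
  rewrite -(integral12_prod_meas1 intD); apply: integral0_eq => s _ /=.
  rewrite /fubini_F /=.
  have dh k y : is_derive y (basis_vec k) (fun y => f (cons_row s y))
      ('D_(basis_vec (lift ord0 k)) f (cons_row s y)).
    exact/is_derive_cons_rowS/(Ck_is_derive _ _ Cf).
  have Ch : Ck (@basis_vec R n) 1 (fun y => f (cons_row s y)).
    apply: (@CkS _ _ _ _ 0 _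
      (fun k y => 'D_(basis_vec (lift ord0 k)) f (cons_row s y))).
      exact: Cslice Cf s.
    move=> k y; apply: (@continuous_comp _ _ _ (cons_row s)
      ('D_(basis_vec (lift ord0 k)) f)); first exact: cons_row_continuous.
    exact: (Ck_continuous (Ck_derive (lift ord0 k) Cf)).
  have bh : cbox M (fun y => f (cons_row s y)).
    split; first exact: Cslice Cf s.
    by move=> x [k Mk]; apply: bf.2; exists (lift ord0 k); rewrite cons_rowS.
  rewrite -[RHS](IH _ j Ch bh); apply: eq_integral => t _.
  by have ? := dh j (row_of t); rewrite derive_val.
rewrite -(integral21_prod_meas1 intD); apply: integral0_eq => t _ /=.
rewrite /fubini_G /=; pose g s := f (cons_row s (row_of t)).
have dg (s : R) : is_derive s 1 g ('D_(basis_vec ord0) f (cons_row s (row_of t))).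
  exact/is_derive_cons_row0/(Ck_is_derive _ _ Cf).
have cg : continuous (fun s => cons_row s (row_of t)).
  move=> s A /nbhs_ballP[e /= e0 eA]; apply/nbhs_ballP; exists e => //= z sz.
  apply: eA; split=> // ? k; rewrite !mxE.
  by case: unliftP => [l _|_]; [exact: ballxx|exact: sz].
have Cg : C1 1 g.
  apply: (@C1S _ 0 _ _ dg) => s.
  apply: (@continuous_comp _ _ _ (fun s => cons_row s (row_of t))
    ('D_(basis_vec ord0) f)); first exact: cg.
  exact: (Ck_continuous (Ck_derive ord0 Cf)).
rewrite -[RHS](@integral_derive_line g M Cg).
  by apply: eq_integral => s _; rewrite (derive1_val (dg s)).
by move=> s Ms; apply: bf.2; exists ord0; rewrite cons_row0.
Qed.

End partial_integral.

(** * Symmetry of second derivatives *)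

Section schwarz.
Context {R : realType} {V : normedModType R}.
Implicit Types (f : V -> R) (a b x : V).

Lemma is_derive_along f a x (s d : R) : is_derive (s *: a + x) a f d ->
  is_derive s 1 (fun s => f (s *: a + x)) d.
Proof.
move=> /(is_derive_lineP f (s *: a + x)) h; apply/(is_derive_lineP _ s (1 : R)).
rewrite (_ : (fun _ => _) = (fun h => f (h *: a + (s *: a + x))))//.
by apply/funext => r; rewrite [_%:A]mulr1 scalerDl addrA.
Qed.

Lemma mean_value (g dg : R -> R) (h : R) : 0 < h ->
  (forall s : R, is_derive s 1 g (dg s)) ->
  exists2 s, 0 <= s <= h & g h - g 0 = dg s * h.
Proof.
move=> h0 gdg; have [|s sh E] := MVT h0 (fun (r : R) _ => gdg r).
  by apply: continuous_subspaceT => x; exact: is_derive_continuous (gdg x).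
exists s; last by rewrite E subr0.
by move: sh; rewrite in_itv/= => /andP[/ltW-> /ltW->].
Qed.

(** The mean value theorem in the direction [a], then in the direction [b]. *)
Lemma second_difference f a b x (h : R) : 0 < h ->
  (forall y, derivable f y a) -> (forall y, derivable ('D_a f) y b) ->
  exists s : R, exists2 t : R, (0 <= s <= h) && (0 <= t <= h) &
    f (h *: a + (h *: b + x)) - f (h *: a + x) - f (h *: b + x) + f x =
    'D_b ('D_a f) (t *: b + (s *: a + x)) * h ^+ 2.
Proof.
move=> h0 da db.
have d1 (s : R) : is_derive s 1 (fun s => f (s *: a + (h *: b + x)) - f (s *: a + x))
    ('D_a f (s *: a + (h *: b + x)) - 'D_a f (s *: a + x)).
  exact: (is_derive_subf (is_derive_along (derivableP (da _)))
    (is_derive_along (derivableP (da _)))).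
have [s sh E1] := mean_value h0 d1.
have d2 (t : R) : is_derive t 1 (fun t => 'D_a f (t *: b + (s *: a + x)))
    ('D_b ('D_a f) (t *: b + (s *: a + x))).
  exact: (is_derive_along (derivableP (db _))).
have [t th E2] := mean_value h0 d2.
exists s, t; first by rewrite sh th.
move: E1 E2; rewrite /= !scale0r !add0r [s *: a + (h *: b + x)]addrCA => E1 E2.
by rewrite expr2 mulrA -E2 -E1; ring.
Qed.

(** Second differences are symmetric in the two directions, so two continuous
    functions that both represent them by mean values coincide. *)
Lemma eq_of_second_difference f a b (P Q : V -> R) :
  (forall x (h : R), 0 < h ->
    exists s : R, exists2 t : R, (0 <= s <= h) && (0 <= t <= h) &
    f (h *: a + (h *: b + x)) - f (h *: a + x) - f (h *: b + x) + f x =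
    P (t *: b + (s *: a + x)) * h ^+ 2) ->
  (forall x (h : R), 0 < h ->
    exists s : R, exists2 t : R, (0 <= s <= h) && (0 <= t <= h) &
    f (h *: b + (h *: a + x)) - f (h *: b + x) - f (h *: a + x) + f x =
    Q (t *: a + (s *: b + x)) * h ^+ 2) ->
  continuous P -> continuous Q -> P = Q.
Proof.
move=> SD1 SD2 cab cba.
apply/funext => x; apply/eqP; rewrite -subr_eq0 -normr_le0 leNgt; apply/negP => PQ.
pose e := `|P x - Q x|; rewrite -/e in PQ.
have e2 : 0 < e / 2 by rewrite divr_gt0.
have [r r0 rP] : exists2 r : R, 0 < r & forall y, `|x - y| < r ->
    `|P x - P y| < e / 2 /\ `|Q x - Q y| < e / 2.
  have /nbhs_normP[r1 /= r10 h1] : \forall y \near x, `|P x - P y| < e / 2.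
    by have /cvgrPdist_lt/(_ _ e2) := cab x.
  have /nbhs_normP[r2 /= r20 h2] : \forall y \near x, `|Q x - Q y| < e / 2.
    by have /cvgrPdist_lt/(_ _ e2) := cba x.
  exists (Num.min r1 r2); first by rewrite lt_min r10.
  by move=> y; rewrite lt_min => /andP[y1 y2]; split; [exact: h1|exact: h2].
pose N := `|a| + `|b| + 1; have N0 : 0 < N by rewrite ltr_wpDl// addr_ge0.
pose h := r / (2 * N); have h0 : 0 < h by rewrite divr_gt0// mulr_gt0.
have close (s t : R) c d : (0 <= s <= h) && (0 <= t <= h) -> `|c| + `|d| + 1 = N ->
    `|x - (t *: d + (s *: c + x))| < r.
  move=> /andP[/andP[s0 sh] /andP[t0 th]] cd.
  have -> : x - (t *: d + (s *: c + x)) = - (t *: d + s *: c).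
    by rewrite [t *: d + (_ + _)]addrA [- (_ + x)]opprD addrCA subrr addr0.
  rewrite normrN.
  rewrite (le_lt_trans (ler_normD _ _))// !normrZ (ger0_norm s0) (ger0_norm t0).
  apply: (@le_lt_trans _ _ (h * `|d| + h * `|c|)).
    by apply: lerD; exact: ler_wpM2r.
  have : h * N < r by rewrite /h invfM mulrA divfK ?gt_eqF// ltr_pdivrMr// ltr_pMr// ltr1n.
  by apply: le_lt_trans; rewrite -mulrDr ler_wpM2l ?(ltW h0)// -cd; lra.
have [s [t st E1]] := SD1 x h h0.
have [s' [t' st' E2]] := SD2 x h h0.
have [P1 _] := rP _ (close s t a b st erefl).
have [_ Q1] := rP _ (close s' t' b a st' (congr1 (fun z => z + 1) (addrC _ _))).
have PQE : P (t *: b + (s *: a + x)) = Q (t' *: a + (s' *: b + x)).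
  have h20 : h ^+ 2 != 0 by rewrite expf_neq0// gt_eqF.
  apply: (mulIf h20); rewrite -E1 -E2 [h *: a + (h *: b + x)]addrCA.
  by move: (f _) (f (h *: a + x)) (f (h *: b + x)) (f x) => A B C D; ring.
have : e < e / 2 + e / 2.
  rewrite /e (le_lt_trans (ler_distD (P (t *: b + (s *: a + x))) _ _))//.
  by rewrite ltrD// PQE distrC.
by rewrite -splitr ltxx.
Qed.

Lemma schwarz f a b : (forall y, derivable f y a) -> (forall y, derivable f y b) ->
  (forall y, derivable ('D_a f) y b) -> (forall y, derivable ('D_b f) y a) ->
  continuous ('D_b ('D_a f)) -> continuous ('D_a ('D_b f)) ->
  'D_b ('D_a f) = 'D_a ('D_b f).
Proof.
move=> da db dab dba cab cba.
exact: (eq_of_second_difference (fun x h h0 => second_difference x h0 da dab)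
  (fun x h h0 => second_difference x h0 db dba) cab cba).
Qed.

End schwarz.

(** * A weighted Hardy-Rellich inequality *)

Section hardy_rellich.
Context {R : realType} {n : nat}.
Variables (M : R) (O : set 'rV[R]_n).
Hypotheses (oO : open O) (OM : forall x : 'rV[R]_n, (exists i, M < `|x ord0 i|) -> O x).
Implicit Types f g phi psi : 'rV[R]_n -> R.

Local Notation D i f := ('D_(basis_vec i) f).

Definition vanish f := forall x, O x -> f x = 0.

(** The open set [O] stands for the complement of the support of the test function.
    Vanishing on [O] is inherited by all derivatives, with the same [O]. *)
Definition smooth0 f := is_smooth f /\ vanish f.

Definition intRn f : R := \int[lebesgue_tuple n]_t f (row_of t).

Lemma vanish_cbox f : continuous f -> vanish f -> cbox M f.
Proof. by move=> cf vf; split=> // x /OM /vf. Qed.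

Lemma integral_RnE f : continuous f -> vanish f -> integral_Rn f = (intRn f)%:E.
Proof.
move=> cf vf; rewrite fineK//; apply: integrable_fin_num => //.
exact: (cbox_integrable (vanish_cbox cf vf)).
Qed.

Lemma intRnD f g : continuous f -> vanish f -> continuous g -> vanish g ->
  intRn (fun x => f x + g x) = intRn f + intRn g.
Proof.
move=> cf vf cg vg; apply: RintegralD => //.
- exact: (cbox_integrable (vanish_cbox cf vf)).
- exact: (cbox_integrable (vanish_cbox cg vg)).
Qed.

Lemma intRnZ c f : continuous f -> vanish f -> intRn (fun x => c * f x) = c * intRn f.
Proof.
move=> cf vf; apply: RintegralZl => //.
exact: (cbox_integrable (vanish_cbox cf vf)).
Qed.

Lemma intRn_sum (J : Type) (r : seq J) (f : J -> 'rV[R]_n -> R) :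
  (forall j, continuous (f j)) -> (forall j, vanish (f j)) ->
  intRn (fun x => \sum_(j <- r) f j x) = \sum_(j <- r) intRn (f j).
Proof.
move=> cf vf; elim: r => [|j r IH].
  rewrite big_nil (_ : (fun _ => _) = fun x => 0 * 0); last first.
    by apply/funext => x; rewrite big_nil mul0r.
  rewrite (@intRnZ 0 (cst 0)) ?mul0r//; exact: cst_continuous.
rewrite big_cons -IH -intRnD//.
- by congr intRn; apply/funext => x; rewrite big_cons.
- exact: (Ck_sum (e := @basis_vec R n) (k := 0)).
- by move=> x Ox /=; rewrite big1// => k _; exact: vf.
Qed.

Lemma intRn_le f g : continuous f -> vanish f -> continuous g -> vanish g ->
  (forall x, f x <= g x) -> intRn f <= intRn g.
Proof.
move=> cf vf cg vg fg; apply: le_Rintegral => //.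
- exact: (cbox_integrable (vanish_cbox cf vf)).
- exact: (cbox_integrable (vanish_cbox cg vg)).
Qed.

Lemma intRn_partial f i : Ck (@basis_vec R n) 1 f -> vanish f -> intRn (D i f) = 0.
Proof.
move=> Cf vf; rewrite /intRn /Rintegral.
by rewrite (integral_partial i Cf (vanish_cbox (Ck_continuous Cf) vf)).
Qed.

Lemma smooth0_Ck k f : smooth0 f -> Ck (@basis_vec R n) k f.
Proof. by move=> [Cf _]; apply/is_CkE; exact: Cf. Qed.

Lemma smooth0_continuous f : smooth0 f -> continuous f.
Proof. by move=> /(@smooth0_Ck 0). Qed.

Lemma smooth0_derive f i : smooth0 f -> smooth0 (D i f).
Proof.
move=> Sf; split; first by move=> k; apply/is_CkE; exact: Ck_derive (smooth0_Ck k.+1 Sf).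
exact: derive_vanish oO Sf.2.
Qed.

Lemma smooth0M f g : smooth0 f -> (forall k, Ck (@basis_vec R n) k g) ->
  smooth0 (fun x => f x * g x).
Proof.
move=> Sf Cg; split; last by move=> x /Sf.2 ->; rewrite mul0r.
by move=> k; apply/is_CkE/CkM => //; exact: smooth0_Ck.
Qed.

Lemma smooth0_sqr f : smooth0 f -> smooth0 (fun x => f x ^+ 2).
Proof. by move=> Sf; apply: smooth0M => // k; exact: smooth0_Ck. Qed.

Lemma smooth0_sum (J : Type) (r : seq J) (f : J -> 'rV[R]_n -> R) :
  (forall j, smooth0 (f j)) -> smooth0 (fun x => \sum_(j <- r) f j x).
Proof.
move=> Sf; split; first by move=> k; apply/is_CkE/Ck_sum => j; exact: smooth0_Ck.
by move=> x Ox /=; rewrite big1// => k _; exact: (Sf k).2.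
Qed.

Lemma smooth0_is_derive f i x : smooth0 f -> is_derive x (basis_vec i) f (D i f x).
Proof. by move=> /(@smooth0_Ck 1) Cf; exact: Ck_is_derive Cf. Qed.

Lemma integration_by_parts_Rn f g i : smooth0 f -> smooth0 g ->
  intRn (fun x => D i f x * g x) = - intRn (fun x => f x * D i g x).
Proof.
move=> Sf Sg; have Sfg := smooth0M Sf (fun k => smooth0_Ck k Sg).
have := intRn_partial i (smooth0_Ck 1 Sfg) Sfg.2.
rewrite (_ : D i _ = fun x => D i f x * g x + f x * D i g x); last first.
  apply/funext => x; have ? := is_derive_mulf (smooth0_is_derive i x Sf)
    (smooth0_is_derive i x Sg).
  by rewrite derive_val.
have S1 := smooth0M (smooth0_derive i Sf) (fun k => smooth0_Ck k Sg).
have S2 := smooth0M Sf (fun k => smooth0_Ck k (smooth0_derive i Sg)).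
rewrite (intRnD (smooth0_continuous S1) S1.2 (smooth0_continuous S2) S2.2).
by move/eqP; rewrite addr_eq0 => /eqP.
Qed.

Lemma derive_comm f i j : smooth0 f -> D i (D j f) = D j (D i f).
Proof.
move=> Sf; have C2 := smooth0_Ck 2 Sf.
have dk k y : derivable f y (basis_vec k) by exact: Ck_derivable C2.
have dkl k l y : derivable (D k f) y (basis_vec l).
  exact: Ck_derivable (Ck_derive k C2).
have ckl k l : continuous (D l (D k f)).
  exact: Ck_continuous (Ck_derive l (Ck_derive k C2)).
exact: (schwarz (dk j) (dk i) (dkl j i) (dkl i j) (ckl j i) (ckl i j)).
Qed.

Lemma smooth0_laplacian f : smooth0 f -> smooth0 (laplacian f).
Proof.
by move=> Sf; apply: smooth0_sum => i; exact/smooth0_derive/smooth0_derive.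
Qed.

Lemma smooth0_iter_laplacian k f : smooth0 f -> smooth0 (iter k laplacian f).
Proof. by move=> Sf; elim: k => // k; exact: smooth0_laplacian. Qed.

Lemma laplacian_derive f i : smooth0 f -> laplacian (D i f) = D i (laplacian f).
Proof.
move=> Sf; apply/funext => x; apply/esym.
have H j : is_derive x (basis_vec i) (fun x => D j (D j f) x) (D i (D j (D j f)) x).
  exact/smooth0_is_derive/smooth0_derive/smooth0_derive.
have -> : D i (laplacian f) x = \sum_(j < n) D i (D j (D j f)) x.
  by have ? := is_derive_sumf (index_enum 'I_n) xpredT H; exact: derive_val.
apply: eq_bigr => j _; have C1 := derive_comm i j (smooth0_derive j Sf).
have C2 := congr1 (fun h : 'rV[R]_n -> R => D j h) (derive_comm i j Sf).
exact (congr1 (fun h : 'rV[R]_n -> R => h x) (etrans C1 C2)).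
Qed.

Lemma iter_laplacian_derive k f i : smooth0 f ->
  iter k laplacian (D i f) = D i (iter k laplacian f).
Proof.
move=> Sf; elim: k => //= k ->.
by rewrite laplacian_derive//; exact: smooth0_iter_laplacian.
Qed.

(** Integrating by parts twice, one derivative of each factor moves to the other. *)
Lemma intRn_sqr_laplacian f : smooth0 f ->
  intRn (fun x => laplacian f x ^+ 2) =
  \sum_(i < n) \sum_(j < n) intRn (fun x => D j (D i f) x ^+ 2).
Proof.
move=> Sf.
have S2 i j : smooth0 (fun x => D i (D i f) x * D j (D j f) x).
  apply: smooth0M => [|k]; last exact/smooth0_Ck/smooth0_derive/smooth0_derive.
  exact/smooth0_derive/smooth0_derive.
rewrite (_ : (fun x => laplacian f x ^+ 2) =
    fun x => \sum_(i < n) \sum_(j < n) (D i (D i f) x * D j (D j f) x)); last first.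
  apply/funext => x; rewrite expr2 {1}/laplacian mulr_suml.
  by apply: eq_bigr => i _; rewrite /laplacian mulr_sumr.
have S1 i : smooth0 (fun x => \sum_(j < n) (D i (D i f) x * D j (D j f) x)).
  exact: smooth0_sum.
rewrite intRn_sum; [|by move=> i; exact: smooth0_continuous|by move=> i; exact: (S1 i).2].
apply: eq_bigr => i _.
rewrite intRn_sum; [|by move=> j; exact: smooth0_continuous|by move=> j; exact: (S2 i j).2].
apply: eq_bigr => j _.
have Si := smooth0_derive i Sf; have Sj := smooth0_derive j Sf.
apply: etrans (integration_by_parts_Rn i Si (smooth0_derive j Sj)) _.
have E1 := congr1 (fun h : 'rV[R]_n -> R => - intRn (fun x => D i f x * h x)) (derive_comm i j Sj).
apply: etrans E1 _.
apply: etrans (esym (integration_by_parts_Rn j Si (smooth0_derive i Sj))) _.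
exact (congr1 (fun h : 'rV[R]_n -> R => intRn (fun x => D j (D i f) x * h x)) (derive_comm i j Sf)).
Qed.

Section weight.
Variable d : R.
Hypotheses (d0 : 0 < d) (n0 : (0 < n)%N).
Hypothesis O_far : forall x, ~ O x -> n%:R <= d * sqnorm x.

Definition gauss (x : 'rV[R]_n) := expR (- d * sqnorm x).

Lemma Ck_gauss k : Ck (@basis_vec R n) k gauss.
Proof. by apply/Ck_expR/CkZ; exact: Ck_sqnorm. Qed.

Lemma is_derive_gauss i x :
  is_derive x (basis_vec i) gauss (gauss x * (- d * (2 * x ord0 i))).
Proof.
have H := is_derive_mulcf (- d) (is_derive_sqnorm i x).
exact: is_derive_compf H (is_derive_expR _).
Qed.

(** Hardy's inequality: integrate the divergence of [f ^ 2 * gauss * x]. On the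
    support of [f] the weight decays so fast along rays that this divergence is
    negative, up to a term in the gradient of [f]. *)
Lemma hardy f : smooth0 f ->
  intRn (fun x => f x ^+ 2 * gauss x) <=
  4 / d * \sum_(i < n) intRn (fun x => D i f x ^+ 2 * gauss x).
Proof.
move=> Sf.
pose F i x := f x ^+ 2 * (x ord0 i * gauss x).
pose G i x := 2 * (f x * D i f x) * (x ord0 i * gauss x) +
  f x ^+ 2 * (gauss x - 2 * d * x ord0 i ^+ 2 * gauss x).
have SF i : smooth0 (F i).
  apply: (smooth0M (smooth0_sqr Sf)) => k.
  by apply: CkM; [exact: Ck_coord|exact: Ck_gauss].
have DF i : D i (F i) = G i.
  apply/funext => x; have Df := smooth0_is_derive i x Sf.
  have dF := is_derive_mulf (is_derive_mulf Df Df)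
    (is_derive_mulf (is_derive_coord i x (basis_vec i)) (is_derive_gauss i x)).
  rewrite (@derive_val _ _ _ _ _ _ _ dF) basis_vecE eqxx (_ : true%:R = 1 :> R)// /G.
  by move: (D i f x) (gauss x) => a b; ring.
have SG i : smooth0 (G i) by rewrite -DF; exact: smooth0_derive.
have IG : intRn (fun x => \sum_(i < n) G i x) = 0.
  rewrite intRn_sum; [|by move=> i; exact: smooth0_continuous|by move=> i; exact: (SG i).2].
  by rewrite big1// => i _; rewrite -DF; exact: intRn_partial (smooth0_Ck 1 (SF i)) (SF i).2.
have Sg := smooth0_sum (index_enum 'I_n) SG.
pose H i x := D i f x ^+ 2 * gauss x.
have SH i : smooth0 (H i).
  exact: smooth0M (smooth0_sqr (smooth0_derive i Sf)) Ck_gauss.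
have Sh := smooth0_sum (index_enum 'I_n) SH.
have S1 := smooth0M (smooth0_sqr Sf) Ck_gauss.
have S2 : smooth0 (fun x => 2 / d * \sum_(i < n) H i x).
  split; first by move=> k; apply/is_CkE/CkZ; exact: smooth0_Ck Sh.
  by move=> x Ox; rewrite Sh.2// mulr0.
have S3 : smooth0 (fun x => - 2^-1 * (f x ^+ 2 * gauss x)).
  split; first by move=> k; apply/is_CkE/CkZ; exact: smooth0_Ck S1.
  by move=> x Ox; rewrite S1.2// mulr0.
have S4 : smooth0 (fun x => 2 / d * (\sum_(i < n) H i x) +
    - 2^-1 * (f x ^+ 2 * gauss x)).
  split; first by move=> k; apply/is_CkE/CkD; [exact: smooth0_Ck S2|exact: smooth0_Ck S3].
  by move=> x Ox; rewrite S2.2// S3.2// addr0.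
have pt x : \sum_(i < n) G i x <=
    2 / d * (\sum_(i < n) H i x) + - 2^-1 * (f x ^+ 2 * gauss x).
  have [Ox|nOx] := pselect (O x).
    by rewrite Sg.2// S4.2.
  have rho := O_far nOx; have g0 : 0 < gauss x by exact: expR_gt0.
  have Gi i : G i x <= 2 / d * H i x + f x ^+ 2 * gauss x -
      3 / 2 * d * (f x ^+ 2 * gauss x) * x ord0 i ^+ 2.
    rewrite /G /H; move: (D i f x) (gauss x) g0 (f x) (x ord0 i) => a b b0 c y.
    rewrite -subr_ge0.
    have -> : 2 / d * (a ^+ 2 * b) + c ^+ 2 * b - 3 / 2 * d * (c ^+ 2 * b) * y ^+ 2 -
        (2 * (c * a) * (y * b) + c ^+ 2 * (b - 2 * d * y ^+ 2 * b)) =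
        (2 / d) * b * (a - d / 2 * (c * y)) ^+ 2.
      by field; rewrite gt_eqF.
    have d2 : 0 <= 2 / d by rewrite divr_ge0// ltW.
    by rewrite mulr_ge0 ?sqr_ge0// mulr_ge0// ltW.
  apply: (le_trans (ler_sum _ (fun i _ => Gi i))).
  rewrite big_split/= big_split/= -mulr_sumr sumr_const card_ord sumrN -mulr_sumr.
  rewrite -/(sqnorm x) -[_ * _ *+ n]mulr_natl.
  have fg0 : 0 <= f x ^+ 2 * gauss x by rewrite mulr_ge0 ?sqr_ge0// ltW.
  have n1 : (1 : R) <= n%:R by rewrite ler1n.
  move: rho fg0; move: (f x ^+ 2 * gauss x) (2 / d * _) (sqnorm x) => A B s rho A0.
  have : 0 <= A * (3 / 2 * (d * s) - n%:R - 2^-1) by rewrite mulr_ge0//; lra.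
  by move: (n%:R : R) => N; nra.
have := intRn_le (smooth0_continuous Sg) Sg.2 (smooth0_continuous S4) S4.2 pt.
rewrite IG (intRnD (smooth0_continuous S2) S2.2 (smooth0_continuous S3) S3.2).
rewrite (intRnZ _ (smooth0_continuous Sh) Sh.2) (intRnZ _ (smooth0_continuous S1) S1.2).
rewrite intRn_sum; [|by move=> i; exact: smooth0_continuous|by move=> i; exact: (SH i).2].
rewrite -/H; move: (\sum_(i < n) _) (intRn _) => X Y.
have -> : 4 / d * X = 2 * (2 / d * X) by field; rewrite gt_eqF.
by move: (2 / d * X) => Z; lra.
Qed.

(** Two applications of Hardy's inequality produce all second derivatives, whose
    total square integral is that of the Laplacian. The weight is the same at each
    step and is finally bounded by 1. *)
Lemma hardy_rellich k f : smooth0 f ->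
  intRn (fun x => f x ^+ 2 * gauss x) <=
  (4 / d) ^+ (2 * k) * intRn (fun x => iter k laplacian f x ^+ 2).
Proof.
have c0 : 0 <= 4 / d by rewrite divr_ge0// ltW.
elim: k f => [|k IH] f Sf.
  rewrite muln0 expr0 mul1r.
  have S1 := smooth0M (smooth0_sqr Sf) Ck_gauss; have S2 := smooth0_sqr Sf.
  apply: (intRn_le (smooth0_continuous S1) S1.2 (smooth0_continuous S2) S2.2) => x.
  rewrite ler_piMr ?sqr_ge0// /gauss -expR0 ler_expR mulNr oppr_le0.
  by rewrite mulr_ge0 ?sqnorm_ge0// ltW.
apply: le_trans (hardy Sf) _.
set c := 4 / d in c0 IH *.
have -> : c ^+ (2 * k.+1) = c * (c * c ^+ (2 * k)) by rewrite mulnS !exprS.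
rewrite -[leRHS]mulrA -[c * _ * intRn _]mulrA; apply: ler_wpM2l => //.
rewrite iterS (intRn_sqr_laplacian (smooth0_iter_laplacian k Sf)) !mulr_sumr.
apply: ler_sum => i _; apply: le_trans (hardy (smooth0_derive i Sf)) _.
apply: ler_wpM2l => //; rewrite mulr_sumr; apply: ler_sum => j _.
have Sij := smooth0_derive j (smooth0_derive i Sf).
have E1 := iter_laplacian_derive k j (smooth0_derive i Sf).
have E2 := congr1 (fun h : 'rV[R]_n -> R => D j h) (iter_laplacian_derive k i Sf).
have E := congr1 (fun h : 'rV[R]_n -> R => intRn (fun x => h x ^+ 2)) (etrans E1 E2).
by have := IH _ Sij; rewrite [X in _ <= _ * X -> _]E.
Qed.

End weight.
End hardy_rellich.

(** * Stability outside a compact set *)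

Section stability.
Context {R : realType} {n : nat}.
Hypothesis n0 : (0 < n)%N.

Lemma row_coord_le_norm (x : 'rV[R]_n) i : `|x ord0 i| <= `|x|.
Proof.
rewrite [leRHS]/Num.norm /= mx_normrE; apply/bigmax_geP; right => /=.
by exists (ord0, i).
Qed.

(** Far away [expR v] is smaller than any given multiple of a Gaussian, hence
    dominated through the Hardy-Rellich inequality. *)
Lemma radial_decay_stable (m : nat) (v : R -> R) (d b : R) : ~~ odd m ->
  0 < d -> (forall r, b <= r -> v r <= - d * r ^+ 2) ->
  continuous (radial v : 'rV[R]_n -> R) ->
  stable_outside_compact m (radial v : 'rV[R]_n -> R).
Proof.
move=> mE d0 vb cv.
pose e := d / 2; have e0 : 0 < e by rewrite divr_gt0.
pose c := 4 / e; have c0 : 0 < c by rewrite divr_gt0.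
(* Beyond the radius r0, half of the decay of [expR (v r)] absorbs the constant
   [c ^ m] of the Hardy-Rellich inequality, and the other half is the weight. *)
pose r0 := Num.max 1 (Num.max b ((n%:R + c ^+ m) / e)).
have r01 : 1 <= r0 by rewrite le_max lexx.
have r0b : b <= r0 by rewrite !le_max lexx !orbT.
have r0e : (n%:R + c ^+ m) / e <= r0 by rewrite !le_max lexx !orbT.
have r00 : 0 <= r0 by exact: le_trans ler01 r01.
exists [set x : 'rV[R]_n | forall i, `[- r0, r0]%classic (x ord0 i)]; split.
  by apply: (@rV_compact _ _ (fun=> `[- r0, r0]%classic)) => _; exact: segment_compact.
move=> phi [sphi cphi Kphi].
set S := closure _ in cphi Kphi.
pose O : set 'rV[R]_n := ~` S.
have oO : open O by apply: closed_openC; exact: closed_closure.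
have [M OM] : exists M : R, forall x : 'rV[R]_n, (exists i, M < `|x ord0 i|) -> O x.
  have [M [Mr SM]] := compact_bounded cphi.
  exists (M + 1) => x [i Mi] Sx.
  have xM : `|x| <= M + 1 by apply: SM Sx; rewrite ltrDl.
  by have := lt_le_trans Mi (row_coord_le_norm x i); rewrite ltNge xM.
have Sphi : smooth0 O phi.
  split=> // x Ox; apply/eqP/negPn/negP => phi0; apply: Ox.
  exact: subset_closure.
have far x : ~ O x -> r0 <= euclidean_norm x.
  move=> /contrapT Sx; have := Kphi x Sx; rewrite /= -existsNP => -[i].
  rewrite in_itv/= -ler_norml => /negP; rewrite -ltNge => /ltW h.
  exact: le_trans h (coord_le_euclidean_norm x i).
have far2 x : ~ O x -> n%:R + c ^+ m <= e * sqnorm x.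
  move=> /far rx; rewrite -sqr_euclidean_norm mulrC -ler_pdivrMr//.
  apply: le_trans r0e _; apply: le_trans (rx) _.
  by rewrite expr2 ler_peMr// (le_trans _ rx)// (le_trans r01).
have O_far x : ~ O x -> n%:R <= e * sqnorm x.
  by move=> /far2; apply: le_trans; rewrite lerDl exprn_ge0// ltW.
have HR := hardy_rellich oO OM e0 n0 O_far m./2 Sphi.
have m2 : (2 * m./2 = m)%N by rewrite mul2n even_halfK.
rewrite m2 -/c in HR.
have SL := smooth0_iter_laplacian oO m./2 Sphi.
have S1 := smooth0_sqr SL; have S2 := smooth0_sqr Sphi.
have S3 := smooth0M S2 (Ck_gauss e).
have cw : continuous (fun x : 'rV[R]_n => expR (radial v x) * phi x ^+ 2).
  apply: continuous_mulf; last exact: smooth0_continuous S2.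
  exact: (continuous_compf (@continuous_expR R) cv).
have vw : vanish O (fun x => expR (radial v x) * phi x ^+ 2).
  by move=> x Ox; rewrite S2.2// mulr0.
have -> : (fun x => `|iter m./2 laplacian phi x| ^+ 2) =
    fun x => iter m./2 laplacian phi x ^+ 2.
  by apply/funext => x; rewrite real_normK ?num_real.
rewrite (integral_RnE OM (smooth0_continuous S1) S1.2) (integral_RnE OM cw vw).
rewrite -EFinB lee_fin subr_ge0.
have cm0 : 0 < c ^+ m by rewrite exprn_gt0.
have S4 : smooth0 O (fun x => c ^- m * (phi x ^+ 2 * gauss e x)).
  split; first by move=> k; apply/is_CkE/CkZ; exact: smooth0_Ck S3.
  by move=> x Ox; rewrite S3.2// mulr0.
apply: (@le_trans _ _ (intRn (fun x => c ^- m * (phi x ^+ 2 * gauss e x)))).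
  apply: (intRn_le OM cw vw (smooth0_continuous S4) S4.2) => x.
  have [Ox|nOx] := pselect (O x); first by rewrite vw// S4.2.
  rewrite [leRHS]mulrCA [leLHS]mulrC; apply: ler_wpM2l; first exact: sqr_ge0.
  rewrite mulrC ler_pdivlMr//.
  apply: (@le_trans _ _ (expR (- (2 * (e * sqnorm x))) * expR (e * sqnorm x))).
    apply: ler_pM; [exact: expR_ge0|exact: ltW| |].
      rewrite ler_expR /radial -sqr_euclidean_norm mulrA.
      have -> : 2 * e = d by rewrite /e mulrC divfK.
      by rewrite -mulNr; apply: vb; apply: le_trans r0b _; exact: far.
    have := far2 x nOx; have := expR_ge1Dx (e * sqnorm x).
    by have : (0 : R) <= n%:R by []; lra.
  by rewrite -expRD /gauss mulNr le_eqVlt; apply/orP; left; apply/eqP; congr expR; ring.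
by rewrite (intRnZ OM _ (smooth0_continuous S3) S3.2) ler_pdivrMl.
Qed.

End stability.

Theorem theorem3p5 (R : realType) (n m : nat)
    (hn : (3 <= n)%N) (hm : (2 <= m)%N) (hm_even : ~~ odd m)
    (alpha : R) (beta : 'rV[R]_m.-1)
    (hbeta : (global_data n m alpha)° beta)
    (T : \bar R) (u : R -> R)
    (hu : maximal_radial_solution n m alpha beta T u) :
  entire_solution m (radial u : 'rV[R]_n -> R) /\
  stable_outside_compact m (radial u : 'rV[R]_n -> R).
Proof.
case: n hn hbeta hu => [//|p] hn hbeta hu.
have [su [d d0 [b ub]]] := profile_decay hm hm_even hbeta hu.
have Eu := radial_entire_solution hm hm_even su; split=> //.
have cu : continuous (radial u : 'rV[R]_p.+1 -> R).
  by have [/is_CkE Cu _] := Eu; exact: Ck_continuous Cu.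
by apply: (radial_decay_stable _ hm_even d0 ub cu).
Qed.
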